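(* Let $F$ be a finite field with $|F|=q$. Let $n_1,n_2,\dots$ be odd integers $>1$ coprime to $q$ such that $\lim_{i\to\infty}\frac{\log_q n_i}{\mu_q(n_i)}=0$. Let $G_i$ be any abelian group of order $n_i$ for $i=1,2,\dots$. Then: (1) There exist self-orthogonal $2$-quasi-$FG_i$ codes $C_i$ of dimension $n_i-1$, $i=1,2,\dots$, such that the code sequence $C_1,C_2,\dots$ is asymptotically good. (2) If $-1$ is a square in $F$, then there exist self-dual $2$-quasi-$FG_i$ codes $C_i$, $i=1,2,\dots$, such that the code sequence $C_1,C_2,\dots$ is asymptotically good.
   Context: For an integer $n>1$ coprime to $q$, the $q$-cyclotomic cosets of $\mathbb{Z}_n=\mathbb{Z}/n\mathbb{Z}$ are the orbits of multiplication by $q$ on $\mathbb{Z}_n$; $\{0\}$ is the trivial one, and $\mu_q(n)$ is the minimal size of the non-trivial $q$-cyclotomic cosets. For an abelian group $G$ of order $n$, $FG$ is the group algebra; $a=\sum_{x\in G}a_xx\in FG$ is identified with the word $(a_x)_{x\in G}\in F^n$, and $(FG)^2=FG\times FG$ with $F^{2n}$. The Hamming weight $\mathrm{w}(a,b)$ of $(a,b)\in(FG)^2$ is the number of nonzero coordinates among the $2n$ coordinates. The inner product on $(FG)^2$ is the Euclidean one: $\langle(a,b),(a',b')\rangle=\sum_{x\in G}(a_xa'_x+b_xb'_x)$. A $2$-quasi-$FG$ code is an $FG$-submodule $C$ of $(FG)^2$; it is a linear code of length $2n$. $C$ is self-orthogonal if $C\subseteq C^\perp$ and self-dual if $C=C^\perp$.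 Its rate is $R(C)=\frac{\dim_F C}{2n}$ and its relative minimum distance is $\Delta(C)=\frac{\mathrm{w}(C)}{2n}$, where $\mathrm{w}(C)$ is the minimum Hamming weight of the nonzero elements of $C$. A code sequence $C_1,C_2,\dots$ is asymptotically good if the length of $C_i$ goes to infinity and both $R(C_i)$ and $\Delta(C_i)$, $i=1,2,\dots$, are bounded from below by a positive constant. *)

(* Defs.v *)
From HB Require Import structures.
From mathcomp Require Import all_boot all_order all_algebra fingroup.
From mathcomp Require Import all_classical all_reals all_analysis.

Set Implicit Arguments.
Unset Strict Implicit.
Unset Printing Implicit Defensive.

Import Order.TTheory GRing.Theory Num.Theory.
Import numFieldNormedType.Exports.

Local Open Scope ring_scope.

(* The group algebra FG with G = gT: a function a stands for the formal sum of
   the a x times x, so that multiplication is convolution.  The alias keeps this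
   product apart from the pointwise one on finite functions. *)
Definition grpalg (F : finFieldType) (gT : finGroupType) := {ffun gT -> F^o}.

Section GroupAlgebra.
Variables (F : finFieldType) (gT : finGroupType).

HB.instance Definition _ := Vector.copy (grpalg F gT) {ffun gT -> F^o}.
HB.instance Definition _ := Finite.copy (grpalg F gT) {ffun gT -> F^o}.

Implicit Types a b c : grpalg F gT.

Definition grpalg_one : grpalg F gT := [ffun x => (x == 1%g)%:R].

Definition grpalg_mul a b : grpalg F gT :=
  [ffun z => \sum_(x : gT) a x * b (x^-1 * z)%g].

Fact grpalg_mulA : associative grpalg_mul.
Proof.
move=> a b c; apply/ffunP=> z; rewrite !ffunE.
under eq_bigr => x _ do rewrite ffunE big_distrr /=.
under [RHS]eq_bigr => y _ do rewrite ffunE big_distrl /=.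
rewrite [RHS]exchange_big /=; apply: eq_bigr => x _.
rewrite [RHS](reindex_inj (mulgI x)) /=; apply: eq_bigr => y _.
by rewrite mulKg invMg !mulgA mulrA.
Qed.

Fact grpalg_mul1l : left_id grpalg_one grpalg_mul.
Proof.
move=> a; apply/ffunP=> z; rewrite ffunE (bigD1 1%g) //= ffunE eqxx mul1r.
rewrite invg1 mul1g big1 ?addr0 // => x /negPf x1.
by rewrite ffunE x1 mul0r.
Qed.

Fact grpalg_mul1r : right_id grpalg_one grpalg_mul.
Proof.
move=> a; apply/ffunP=> z; rewrite ffunE (bigD1 z) //= ffunE mulVg eqxx mulr1.
rewrite big1 ?addr0 // => x xz; rewrite ffunE -eq_invg_mul invgK.
by rewrite (negPf xz) mulr0.
Qed.

Fact grpalg_mulDl : left_distributive grpalg_mul +%R.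
Proof.
move=> a b c; apply/ffunP=> z; rewrite !ffunE -big_split /=.
by apply: eq_bigr => x _; rewrite ffunE mulrDl.
Qed.

Fact grpalg_mulDr : right_distributive grpalg_mul +%R.
Proof.
move=> a b c; apply/ffunP=> z; rewrite !ffunE -big_split /=.
by apply: eq_bigr => x _; rewrite ffunE mulrDr.
Qed.

Fact grpalg_oner_neq0 : grpalg_one != 0.
Proof.
apply/eqP => /ffunP /(_ 1%g); rewrite !ffunE eqxx => /eqP.
by rewrite oner_eq0.
Qed.

HB.instance Definition _ := GRing.Zmodule_isNzRing.Build (grpalg F gT)
  grpalg_mulA grpalg_mul1l grpalg_mul1r grpalg_mulDl grpalg_mulDr
  grpalg_oner_neq0.

Fact grpalg_scaleAl (k : F) a b : k *: (a * b) = (k *: a) * b.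
Proof.
apply/ffunP=> z; rewrite !ffunE scaler_sumr.
by apply: eq_bigr => x _; rewrite ffunE scalerAl.
Qed.

HB.instance Definition _ :=
  GRing.Lmodule_isLalgebra.Build F (grpalg F gT) grpalg_scaleAl.

Fact grpalg_scaleAr (k : F) a b : k *: (a * b) = a * (k *: b).
Proof.
apply/ffunP=> z; rewrite !ffunE scaler_sumr.
by apply: eq_bigr => x _; rewrite ffunE scalerAr.
Qed.

HB.instance Definition _ :=
  GRing.Lalgebra_isAlgebra.Build F (grpalg F gT) grpalg_scaleAr.

End GroupAlgebra.

Definition grpalg2 (F : finFieldType) (gT : finGroupType) : Type :=
  (grpalg F gT * grpalg F gT)%type.

Section Codes.
Variables (F : finFieldType) (gT : finGroupType).

HB.instance Definition _ :=
  Vector.copy (grpalg2 F gT) (grpalg F gT * grpalg F gT)%type.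
HB.instance Definition _ :=
  Finite.copy (grpalg2 F gT) (grpalg F gT * grpalg F gT)%type.

Implicit Types (u v : grpalg2 F gT) (C : {vspace grpalg2 F gT}).

(* An FG-submodule is in particular an F-subspace, as F embeds in FG; hence it
   is an F-subspace stable under the diagonal action of FG. *)
Definition quasi_code2 C : Prop :=
  forall (a : grpalg F gT) u, u \in C -> ((a * u.1, a * u.2) : grpalg2 F gT) \in C.

Definition hweight u : nat :=
  (#|[pred x | u.1 x != 0%R]| + #|[pred x | u.2 x != 0%R]|)%N.

Definition inner u v : F := \sum_(x : gT) (u.1 x * v.1 x + u.2 x * v.2 x).

Definition dual_code C : {pred grpalg2 F gT} :=
  [pred v | [forall u in C, inner u v == 0]].

Definition self_orthogonal C : Prop := {subset C <= dual_code C}.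

Definition self_dual C : Prop := C =i dual_code C.

(* vpick C is a nonzero element of C unless C = 0, in which case the minimum is
   over the empty set and min_weight C is 0. *)
Definition min_weight C : nat :=
  hweight [arg min_(u < vpick C | (u \in C) && (u != 0%R)) hweight u]%N.

Definition code_length : nat := (2 * #|gT|)%N.

Definition rate (R : realType) C : R := (\dim C)%:R / code_length%:R.

Definition rel_min_dist (R : realType) C : R :=
  (min_weight C)%:R / code_length%:R.

End Codes.

Arguments code_length gT : clear implicits.

Definition asymptotically_good (R : realType) (F : finFieldType)
    (gT : nat -> finGroupType) (C : forall i, {vspace grpalg2 F (gT i)}) : Prop :=
  ((fun i => code_length (gT i)) @ \oo --> \oo)%classic /\
  exists2 c : R, 0 < c &
    forall i, c <= rate R (C i) /\ c <= rel_min_dist R (C i).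

Arguments asymptotically_good R {F gT} C.

Section CyclotomicCosets.
Variables (q n : nat).

(* 'Z_n is the ring of integers mod n only for 1 < n.  For q coprime to n,
   multiplication by q is a permutation and these are its orbits. *)
Definition cyclotomic_coset (x : 'Z_n) : {set 'Z_n} :=
  [set y in orbit (fun z : 'Z_n => q%:R * z) x]%SET.

Definition cyclotomic_cosets : {set {set 'Z_n}} :=
  [set cyclotomic_coset x | x : 'Z_n]%SET.

Definition nontrivial_cosets : {set {set 'Z_n}} :=
  [set A in cyclotomic_cosets | A != [set 0]]%SET.

(* The coset of 1 only serves as a witness: it is non-trivial as 1 != 0. *)
Definition mu : nat :=
  #|[arg min_(A < cyclotomic_coset 1%R in nontrivial_cosets) #|A|]%N|.

End CyclotomicCosets.

Definition logb (R : realType) (b x : R) : R := ln x / ln b.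

(* Main.v *)
(* Write e for the complement 1 - e0 of the averaging idempotent e0 of FG, and bar
   for the involution of FG inverting the group elements.  If b = b e satisfies
   b bar(b) = -e, then {(a e, a b)} is self-orthogonal of dimension n - 1; if
   moreover x^2 = -1, then {(a, a (b + x e0))} is self-dual.  Frobenius gives
   a^Q = a on FG for some Q > 2, so every a has a support idempotent a^(Q-1), and
   statements about bar-stable idempotents reduce to atoms.  There every b exists
   by a counting argument, and the norm-one elements v / bar(v) are so plentiful
   that a given pair (a, c) satisfies c = a b for a random b with probability at
   most |FG f|^(-1/2), where f is the bar-stable support of a e.  On the other hand FG f has
   few pairs of low weight (compare with the translates of an information set),
   and |FG f| >= q^mu(n) is large, so that a union bound over f leaves a b whose
   code has no nonzero word of low weight as soon as n^8 <= q^mu(n). *)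

From HB Require Import structures.
Require Import Defs.
From mathcomp Require Import all_boot all_order all_algebra fingroup finfield cyclic.
From mathcomp Require Import ring lra zify.
Set Implicit Arguments.
Unset Strict Implicit.
Unset Printing Implicit Defensive.
Import Order.TTheory GRing.Theory Num.Theory.
Local Open Scope ring_scope.

(** * Idempotents of a finite commutative ring with involution *)

Section Idempotents.
Variables (A : finComNzRingType) (bar : {rmorphism A -> A}) (Q : nat).
Hypotheses (barK : involutive bar) (Q_gt2 : (2 < Q)%N).
Hypothesis expQ : forall a : A, a ^+ Q = a.
Implicit Types (a b c e f g h u v w x y : A).

Definition ideal f : {set A} := [set a | a * f == a].
Definition idsupp a := a ^+ Q.-1.
Definition pinv a := a ^+ Q.-2.

Lemma idealP a f : reflect (a * f = a) (a \in ideal f).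
Proof. by rewrite inE; apply: eqP. Qed.

Lemma mul_support a : a * idsupp a = a.
Proof. by rewrite -exprS prednK // (ltn_trans _ Q_gt2). Qed.

Lemma mul_pinv a : a * pinv a = idsupp a.
Proof. by rewrite -exprS /idsupp; case: Q Q_gt2 => [|[|q]]. Qed.

Lemma support_idem a : idsupp a * idsupp a = idsupp a.
Proof. by rewrite -{1}mul_pinv mulrAC mul_support mul_pinv. Qed.

Lemma supportM a b : idsupp (a * b) = idsupp a * idsupp b.
Proof. exact: exprMn. Qed.

Lemma support_bar a : idsupp (bar a) = bar (idsupp a).
Proof. by rewrite rmorphXn. Qed.

Lemma support_eq0 a : idsupp a = 0 -> a = 0.
Proof. by rewrite -{2}[a]mul_support => ->; rewrite mulr0. Qed.

Lemma support_id f : f * f = f -> idsupp f = f.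
Proof.
move=> ff; have fX k : f ^+ k.+1 = f by elim: k => // k IH; rewrite exprS IH.
by rewrite /idsupp; case: Q Q_gt2 => [|[|q]] //= _.
Qed.

Lemma support_mull a f : a * f = a -> idsupp a * f = idsupp a.
Proof. by move=> af; rewrite -mul_pinv mulrAC af. Qed.

Lemma support_opp a : idsupp (- a) = idsupp a.
Proof.
have sN1 : idsupp (- 1) = 1.
  by rewrite -[LHS]opprK -[- idsupp _]mulN1r mul_support opprK.
by rewrite -mulN1r supportM sN1 mul1r.
Qed.

Definition stable f := (f * f == f) && (bar f == f).

Lemma stableP f : reflect (f * f = f /\ bar f = f) (stable f).
Proof. by apply: (iffP andP) => -[/eqP ? /eqP ?]; split=> //; apply/eqP. Qed.

Definition atom f :=
  [&& stable f, f != 0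
    & [forall g, stable g ==> (g * f == g) ==> ((g == 0) || (g == f))]].

Lemma atomP f : atom f ->
  [/\ stable f, f != 0 & forall g, stable g -> g * f = g -> g != 0 -> g = f].
Proof.
case/and3P=> sf f0 /forallP H; split=> // g sg gf g0.
have := H g; rewrite sg gf eqxx (negPf g0) /=; exact: eqP.
Qed.

Lemma stable_bar_fixed w : bar w = w -> stable (idsupp w).
Proof. by move=> wb; apply/stableP; rewrite support_idem -support_bar wb. Qed.

Lemma atom_support_fixed f w :
  atom f -> w * f = w -> bar w = w -> w != 0 -> idsupp w = f.
Proof.
case/atomP=> sf _ H wf wb w0; apply: H; first exact: stable_bar_fixed.
  exact: support_mull.
by apply: contraNneq w0 => /support_eq0 ->.
Qed.

Lemma stable_sub f g : stable f -> stable g -> g * f = g -> stable (f - g).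
Proof.
move=> /stableP[ff fb] /stableP[gg gb] gf; apply/stableP; split; last first.
  by rewrite rmorphB /= fb gb.
rewrite mulrBl !mulrBr ff gg gf (mulrC f g) gf; ring.
Qed.

Lemma stable_ind (e : A) (P : A -> Prop) : P 0 ->
  (forall f g, stable f -> stable g -> f * g = 0 ->
     f * e = f -> g * e = g -> P f -> P g -> P (f + g)) ->
  (forall f, atom f -> f * e = f -> P f) ->
  forall f, stable f -> f * e = f -> P f.
Proof.
move=> P0 PD Patom f; have [m] := ubnP #|ideal f|.
elim: m f => // m IH f; rewrite ltnS => lefm sf fe.
have [->|f0] := eqVneq f 0; first by [].
have [|] := boolP [forall g, stable g ==> (g * f == g) ==> ((g == 0) || (g == f))].
  by move=> H; apply: Patom => //; apply/and3P.
rewrite negb_forall => /existsP[g]; rewrite !negb_imply negb_or.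
case/and4P=> sg /eqP gf g0 gNf.
have [[ff fb] [gg gb]] := (stableP _ sf, stableP _ sg).
have ltI h : stable h -> h * f = h -> h != f -> (#|ideal h| < m)%N.
  move=> sh hf hNf; apply: leq_trans lefm; apply: proper_card.
  apply/properP; split; first by apply/fintype.subsetP=> a /idealP ah; apply/idealP;
    rewrite -ah -mulrA hf.
  by exists f; [apply/idealP | apply: contra hNf => /idealP fh; rewrite -hf mulrC fh].
have sfg := stable_sub sf sg gf.
have -> : f = (f - g) + g by ring.
have ge : g * e = g by rewrite -gf -mulrA fe.
have fge : (f - g) * e = f - g by rewrite mulrBl fe ge.
apply: PD => //; first by rewrite mulrBl gg mulrC gf subrr.
  apply: IH => //; apply: ltI => //; first by rewrite mulrBl ff gf.
  by apply: contra g0 => /eqP E; rewrite -(subKr f g) E subrr.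
by apply: IH => //; apply: ltI.
Qed.

Section Orthogonal.
Variables f g : A.
Hypotheses (ff : f * f = f) (gg : g * g = g) (fg : f * g = 0).

Lemma ideal_addP a b : a \in ideal f -> b \in ideal g ->
  [/\ a + b \in ideal (f + g), (a + b) * f = a & (a + b) * g = b].
Proof.
move=> /idealP af /idealP bg.
have ag : a * g = 0 by rewrite -af -mulrA fg mulr0.
have bf : b * f = 0 by rewrite -bg -mulrA (mulrC g) fg mulr0.
by rewrite !mulrDl af ag bf bg addr0 add0r; split=> //; apply/idealP;
  rewrite !(mulrDl, mulrDr) af ag bf bg; ring.
Qed.

Lemma ideal_split a : a \in ideal (f + g) ->
  [/\ a * f \in ideal f, a * g \in ideal g & a = a * f + a * g].
Proof.
by move=> /idealP aE; split; [apply/idealP..|]; rewrite -?mulrA ?ff ?gg -?mulrDr.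
Qed.

Lemma card_ideal_add : #|ideal (f + g)| = (#|ideal f| * #|ideal g|)%N.
Proof.
rewrite -cardsX; have <- : (fun p => p.1 + p.2) @: setX (ideal f) (ideal g) = ideal (f + g).
  apply/setP=> a; apply/imsetP/idP => [[[p1 p2] /setXP[/= h1 h2] ->]|/ideal_split[af ag aE]].
    by have [] := ideal_addP h1 h2.
  by exists (a * f, a * g) => //; apply/setXP.
rewrite card_in_imset // => -[a b] [a' b'] /setXP[/= a1 b1] /setXP[/= a2 b2] E.
have [[_ E1 E2] [_ E3 E4]] := (ideal_addP a1 b1, ideal_addP a2 b2).
by move: E => /= E; congr (_, _); [rewrite -[LHS]E1 -[RHS]E3 E | rewrite -[LHS]E2 -[RHS]E4 E].
Qed.
End Orthogonal.

Definition fixed f := [set a in ideal f | bar a == a].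

Section Unitary.
Variable e : A.
Hypothesis bar_nontriv :
  forall f, stable f -> f * e = f -> f != 0 -> exists x, bar x * f != x * f.

Lemma atom_antifixed f : atom f -> f * e = f ->
  exists s, [/\ s * f = s, bar s = - s & s != 0].
Proof.
case/atomP=> sf f0 _ fe; have [x xf] := bar_nontriv sf fe f0.
have [ff fb] := stableP _ sf; exists ((x - bar x) * f).
by rewrite -mulrA ff rmorphM rmorphB /= barK fb mulrBl subr_eq0 eq_sym; split=> //; ring.
Qed.

Lemma card_fixed f : stable f -> f * e = f -> (#|fixed f| ^ 2 <= #|ideal f|)%N.
Proof.
move: f; apply: (@stable_ind e (fun f => (#|fixed f| ^ 2 <= #|ideal f|)%N)) => [|f g sf sg fg
  _ _ IHf IHg|f atf fe].
- suff -> : fixed 0 = [set 0].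
    by rewrite cards1; apply/card_gt0P; exists 0; apply/idealP; rewrite mulr0.
  apply/setP=> a; rewrite !inE mulr0 eq_sym.
  by case: eqP => // ->; rewrite rmorph0 eqxx.
- have [[ff fb] [gg gb]] := (stableP _ sf, stableP _ sg).
  rewrite card_ideal_add //; apply: leq_trans (leq_mul IHf IHg).
  rewrite -expnMn leq_exp2r // -cardsX.
  rewrite -(@card_in_imset _ _ (fun a => (a * f, a * g)) (mem (fixed (f + g)))); last first.
    move=> a b /setIdP[aI _] /setIdP[bI _] [E1 E2].
    have [[_ _ Ea] [_ _ Eb]] := (ideal_split ff gg aI, ideal_split ff gg bI).
    by rewrite Ea Eb E1 E2.
  apply/subset_leq_card/fintype.subsetP=> _ /imsetP[a /setIdP[aI /eqP ab] ->].
  by rewrite !inE !rmorphM /= ab fb gb -!mulrA ff gg !eqxx.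
have [sf f0 _] := atomP atf; have [ff fb] := stableP _ sf.
have [x xf] := bar_nontriv sf fe f0.
rewrite expnS expn1 -cardsX -(@card_in_imset _ _ (fun p => p.1 + x * p.2) (mem (setX (fixed
  f) (fixed f)))).
  apply/subset_leq_card/fintype.subsetP=> _ /imsetP[[a b]
    /setXP[/= /setIdP[/idealP af _] /setIdP[/idealP bf _]] ->].
  by apply/idealP; rewrite mulrDl af -mulrA bf.
move=> [a b] [c d] /setXP[/setIdP[/idealP /= af /eqP ab] /setIdP[/idealP /= bf /eqP bb]].
move=> /setXP[/setIdP[/idealP /= cf /eqP cb] /setIdP[/idealP /= df /eqP db]] /= E.
have E2 : x * (b - d) = bar x * (b - d).
  have D : x * (b - d) = c - a.
    by apply: (addIr (a + x * d)); transitivity (a + x * b); [ring | rewrite E; ring].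
  by have := congr1 bar D; rewrite rmorphM !rmorphB /= ab bb cb db D => ->.
have [/eqP|bd] := eqVneq (b - d) 0.
  by rewrite subr_eq0 => /eqP bd; move: E; rewrite bd => /addIr ->.
case/eqP: xf; rewrite -(@atom_support_fixed f (b - d)) // ?rmorphB ?mulrBl ?bf ?df ?bb ?db //.
by rewrite -mul_pinv !mulrA E2.
Qed.

Lemma sqr_fixed_atom f x y : atom f -> x \in fixed f -> y \in fixed f ->
  x * x = y * y -> x = y \/ x = - y.
Proof.
move=> atf /setIdP[/idealP xf /eqP xb] /setIdP[/idealP yf /eqP yb] E.
have E0 : (x - y) * (x + y) = 0 by rewrite mulrDr !mulrBl E; ring.
have [/eqP|xNy] := eqVneq (x - y) 0; first by rewrite subr_eq0 => /eqP; left.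
right; apply/eqP; rewrite -addr_eq0 -[x + y](_ : (x + y) * f = _); last by rewrite mulrDl xf yf.
have <- : idsupp (x - y) = f.
  by apply: atom_support_fixed; rewrite // ?mulrBl ?rmorphB /= ?xf ?yf ?xb ?yb.
by rewrite -mul_pinv mulrA (mulrC (x + y)) E0 mul0r.
Qed.

Lemma fixed_mul f x y : x \in fixed f -> y \in fixed f -> x * y \in fixed f.
Proof.
move=> /setIdP[_ /eqP xb] /setIdP[/idealP yf /eqP yb].
by rewrite !inE -mulrA yf rmorphM /= xb yb !eqxx.
Qed.

Lemma fixed_sub f x y : x \in fixed f -> y \in fixed f -> x - y \in fixed f.
Proof.
move=> /setIdP[/idealP xf /eqP xb] /setIdP[/idealP yf /eqP yb].
by rewrite !inE mulrBl xf yf rmorphB /= xb yb !eqxx.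
Qed.

Lemma card_fixed_squares f : atom f ->
  (#|fixed f| < 2 * #|[set (x * x)%R | x in fixed f]|)%N.
Proof.
move=> atf; set X := [set x * x | x in fixed f].
have K0 : 0 \in fixed f by rewrite !inE mul0r rmorph0 !eqxx.
have X0 : 0 \in X by apply/imsetP; exists 0; rewrite ?mul0r.
have fibre z (c : nat) (S : {set A}) : (#|S| <= c)%N ->
    (forall x, x \in fixed f -> x * x = z -> x \in S) ->
    (\sum_(x in fixed f | (x * x)%R == z) 1 <= c)%N.
  move=> Sc H; rewrite sum1dep_card; apply: leq_trans Sc; apply/subset_leq_card.
  by apply/fintype.subsetP=> x; rewrite inE => /andP[xK /eqP]; apply: H.
rewrite -sum1_card (partition_big_imset (fun x : A => x * x)) /= -/X.
rewrite (big_setD1 0) //= (cardsD1 0) X0 /= mulnDr muln1.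
apply: (@leq_ltn_trans (1 + 2 * #|X :\ 0|)); last by rewrite ltn_add2r.
apply: leq_add.
  apply: (fibre _ _ [set 0]) => [|x xK x2]; first by rewrite cards1.
  by have [|->|->] := @sqr_fixed_atom f x 0 atf xK K0; rewrite ?oppr0 ?inE ?mul0r.
rewrite mulnC -sum_nat_const.
apply: leq_sum => _ /setD1P[_ /imsetP[x xK ->]].
apply: (fibre _ _ [set x; - x]) => [|y yK y2]; first by rewrite cards2; case: (_ != _).
by have [->|->] := sqr_fixed_atom atf yK xK y2; rewrite !inE eqxx ?orbT.
Qed.

(* Over an atom the fixed ring is a finite field K, so the sets of the x^2 and of
   the s^2 y^2 - 1 (x, y in K) meet; then x + s y has norm x^2 - s^2 y^2 = -1. *)
Lemma norm_opp f : stable f -> f * e = f -> exists2 b, b * f = b & b * bar b = - f.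
Proof.
move: f; apply: (@stable_ind e (fun f => exists2 b, b * f = b & b * bar b = - f)).
- by exists 0; rewrite ?mul0r ?oppr0.
- move=> f g sf sg fg _ _ [a af aN] [b bg bN].
  have [[ff fb] [gg gb]] := (stableP _ sf, stableP _ sg).
  have ag : a * g = 0 by rewrite -af -mulrA fg mulr0.
  have bf : b * f = 0 by rewrite -bg -mulrA (mulrC g) fg mulr0.
  exists (a + b); first by rewrite !(mulrDl, mulrDr) af ag bf bg; ring.
  have ab : a * bar b = 0 by rewrite -bg rmorphM /= gb (mulrC (bar b)) mulrA ag mul0r.
  have ba : b * bar a = 0 by rewrite -af rmorphM /= fb (mulrC (bar a)) mulrA bf mul0r.
  by rewrite rmorphD /= !(mulrDl, mulrDr) aN bN ab ba; ring.
move=> f atf fe; have [sf f0 _] := atomP atf; have [ff fb] := stableP _ sf.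
have [s [sF sb s0]] := atom_antifixed atf fe.
have fK : f \in fixed f by rewrite !inE ff fb !eqxx.
have ssK : s * s \in fixed f by rewrite !inE -mulrA sF rmorphM /= sb mulrNN !eqxx.
have sus : idsupp (s * s) = f.
  case/setIdP: (ssK) => /idealP ? /eqP ?; apply: atom_support_fixed => //.
  apply: contra_neq s0 => ss0; apply: support_eq0.
  by rewrite -support_idem -supportM ss0 /idsupp expr0n; case: Q Q_gt2 => [|[]].
pose X := [set x * x | x in fixed f].
pose Y := [set s * s * y - f | y in X].
have cY : #|Y| = #|X|.
  apply: card_in_imset => x y /imsetP[x' x'K ->] /imsetP[y' y'K ->] /addIr E.
  have /setIdP[/idealP xF _] := fixed_mul x'K x'K.
  have /setIdP[/idealP yF _] := fixed_mul y'K y'K.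
  by rewrite -xF -yF -sus -mul_pinv !(mulrC _ (s * s * _)) !(mulrAC _ (pinv _)) E.
have /set0Pn[z /setIP[/imsetP[x xK zx] /imsetP[_ /imsetP[y yK ->] zy]]] : X :&: Y != set0.
  apply: contraTneq (card_fixed_squares atf) => XY0.
  rewrite -leqNgt mul2n -addnn -{2}cY -cardsUI XY0 cards0 addn0.
  apply/subset_leq_card/fintype.subsetP=> _ /setUP[/imsetP[x xK ->]|/imsetP[_ /imsetP[y yK
    ->] ->]].
    exact: fixed_mul.
  by apply: fixed_sub => //; do 2 apply: fixed_mul => //.
case/setIdP: xK => /idealP xF /eqP xb; case/setIdP: yK => /idealP yF /eqP yb.
exists (x + y * s); first by rewrite mulrDl -mulrA sF xF.
have -> : - f = s * s * (y * y) - f - s * s * (y * y) by ring.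
by rewrite -zy zx rmorphD rmorphM /= xb yb sb; ring.
Qed.
End Unitary.
End Idempotents.

Section Counting.
Variables (A : finComNzRingType) (bar : {rmorphism A -> A}) (Q : nat).
Hypothesis Q_gt2 : (2 < Q)%N.
Hypothesis expQ : forall a : A, a ^+ Q = a.
Variables (e : A) (y : nat).
Hypothesis ideal_ge : forall f, f * f = f -> f * e = f -> f != 0 ->
  (y <= #|ideal f|)%N.
Implicit Types (a b c f g h u v w x : A).
Local Notation supp := (idsupp Q).
Local Notation pinv := (@pinv _ Q).

Lemma ideal0 : ideal (0 : A) = [set 0].
Proof. by apply/setP=> a; rewrite !inE mulr0 eq_sym. Qed.

Definition units f := [set v in ideal f | supp v == f].

Lemma card_units (T : realFieldType) (t : T) f :
  0 <= t <= 1 -> 1 <= t * y%:R -> f * f = f -> f * e = f ->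
  exists2 k, (y ^ k <= #|ideal f|)%N & (1 - t) ^+ k * #|ideal f|%:R <= #|units f|%:R.
Proof.
move=> /andP[t0 t1] ty ff; have {ff} : stable idfun f by apply/stableP.
move: f; apply: (@stable_ind A idfun e (fun f => exists2 k, (y ^ k <= #|ideal f|)%N &
  (1 - t) ^+ k * #|ideal f|%:R <= #|units f|%:R)).
- exists 0%N; first by rewrite ideal0 cards1.
  rewrite expr0 mul1r ler_nat ideal0 cards1; apply/card_gt0P; exists 0.
  by rewrite !inE mulr0 /idsupp expr0n; case: Q Q_gt2 => [|[]] //= *; rewrite !eqxx.
- move=> f g /stableP[ff _] /stableP[gg _] fg _ _ [k yk kf] [l yl lg].
  exists (k + l)%N; rewrite card_ideal_add //; first by rewrite expnD leq_mul.
  rewrite exprD natrM mulrACA; apply: (@le_trans _ _ (#|units f|%:R * #|units g|%:R)).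
    by apply: ler_pM => //; rewrite mulr_ge0 ?exprn_ge0 ?subr_ge0.
  rewrite -natrM ler_nat -cardsX -(@card_in_imset _ _ (fun p => p.1 + p.2) (mem (setX (units
    f) (units g)))).
    apply/subset_leq_card/fintype.subsetP=> _ /imsetP[[a b]
      /setXP[/= /setIdP[aI /eqP af] /setIdP[bI /eqP bg]] ->].
    have [abI Ea Eb] := ideal_addP fg aI bI.
    have sE : supp (a + b) * (f + g) = supp (a + b).
      by apply: (support_mull Q_gt2); apply/idealP.
    rewrite inE abI -sE mulrDr -{1}(support_id Q_gt2 ff) -{1}(support_id Q_gt2 gg).
    by rewrite -!supportM Ea Eb af bg /=.
  move=> [a b] [a' b'] /setXP[/= /setIdP[a1 _] /setIdP[b1 _]] /setXP[/= /setIdP[a2 _]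
    /setIdP[b2 _]] E.
  have [[_ E1 E2] [_ E3 E4]] := (ideal_addP fg a1 b1, ideal_addP fg a2 b2).
  by congr (_, _); [rewrite -[LHS]E1 -[RHS]E3 E | rewrite -[LHS]E2 -[RHS]E4 E].
move=> f atf fe; have [/stableP[ff _] f0 _] := atomP atf.
have yf := ideal_ge ff fe f0.
exists 1%N; first by rewrite expn1.
have <- : ideal f :\ 0 = units f.
  apply/setP=> a; apply/setD1P/setIdP=> [[a0 aI]|[aI /eqP aE]]; split=> //.
    by apply/eqP; apply: (atom_support_fixed Q_gt2 expQ atf) => //; apply/idealP.
  apply: contraNneq f0 => a0; rewrite -aE a0 /idsupp expr0n.
  by case: Q Q_gt2 => [|[]].
have I0 : 0 \in ideal f by apply/idealP; rewrite mul0r.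
rewrite expr1 (cardsD1 0 (ideal f)) I0 natrD mulrBl mul1r lerBlDr addrC lerD2l.
rewrite -natrD; apply: (@le_trans _ _ (t * y%:R)) => //.
by rewrite ler_wpM2l // ler_nat; move: yf; rewrite (cardsD1 0 (ideal f)) I0 addnC.
Qed.

Definition root4 (T : rcfType) (x : T) := Num.sqrt (Num.sqrt x).

Lemma sum_weight (T : rcfType) f : (0 < y)%N -> stable bar f -> f * e = f ->
  exists2 k, (y ^ k <= #|ideal f|)%N &
    \sum_(g | stable bar g && (g * f == g)) (root4 #|ideal g|%:R : T)^-1
      <= (1 + (root4 y%:R)^-1) ^+ k.
Proof.
move=> y0; set t := _^-1.
have t0 : 0 <= t by rewrite invr_ge0 sqrtr_ge0.
move: f; apply: (@stable_ind A bar e (fun f => exists2 k, (y ^ k <= #|ideal f|)%N &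
  \sum_(g | stable bar g && (g * f == g)) (root4 #|ideal g|%:R : T)^-1 <= (1 + t) ^+ k)).
- exists 0%N; first by rewrite ideal0 cards1.
  rewrite (big_pred1 0); first by rewrite expr0 ideal0 cards1 /root4 !sqrtr1 invr1.
  move=> g /=; rewrite mulr0 (eq_sym 0); case: eqP => [->|_]; rewrite ?andbF ?andbT //.
  by apply/stableP; rewrite mul0r rmorph0.
- move=> f g sf sg fg _ _ [k yk kf] [l yl lg].
  have [[ff fb] [gg gb]] := (stableP _ _ sf, stableP _ _ sg).
  exists (k + l)%N; rewrite ?card_ideal_add // ?expnD ?leq_mul // exprD.
  set W := fun h => (root4 #|ideal h|%:R : T)^-1.
  set S := fun f => [set h | stable bar h && (h * f == h)].
  have SE h' : \sum_(h | stable bar h && (h * h' == h)) W h = \sum_(h in S h') W h.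
    by apply: eq_bigl => h; rewrite inE.
  rewrite SE; rewrite !SE in kf lg.
  have W0 h : 0 <= W h by rewrite invr_ge0 sqrtr_ge0.
  apply: (@le_trans _ _ ((\sum_(h in S f) W h) * (\sum_(h in S g) W h))); last first.
    by apply: ler_pM => //; apply: sumr_ge0.
  have hS h : h \in S (f + g) -> [/\ h * f \in S f, h * g \in S g, h = h * f + h * g & W h =
    W (h * f) * W (h * g)].
    rewrite inE => /andP[/stableP[hh hb] /eqP hfg].
    have E : h = h * f + h * g by rewrite -mulrDr.
    split=> //.
    - rewrite inE -mulrA ff eqxx andbT; apply/stableP.
      by rewrite mulrACA hh ff rmorphM /= hb fb.
    - rewrite inE -mulrA gg eqxx andbT; apply/stableP.
      by rewrite mulrACA hh gg rmorphM /= hb gb.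
    rewrite /W {1}E card_ideal_add;
      first by rewrite natrM /root4 !sqrtrM ?sqrtr_ge0 ?ler0n // invfM.
    - by rewrite mulrACA hh ff.
    - by rewrite mulrACA hh gg.
    by rewrite mulrACA fg mulr0.
  rewrite mulr_suml; under [leRHS]eq_bigr do rewrite mulr_sumr.
  rewrite pair_big /= [leRHS](eq_bigl (fun p => p \in setX (S f) (S g)));
    last by move=> -[a b]; rewrite /= in_setX.
  rewrite (eq_bigr (fun h => W (h * f) * W (h * g))); last by move=> h /hS[].
  rewrite -(big_imset (fun p => W p.1 * W p.2) (h := fun h => (h * f, h * g))) /=; last first.
    by move=> h h' /hS[_ _ Eh _] /hS[_ _ Eh' _] [E1 E2]; rewrite Eh Eh' E1 E2.
  rewrite [leRHS](big_setID [set (h * f, h * g) | h in S (f + g)]) /=.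
  rewrite (setIidPr _) ?lerDl; first by apply: sumr_ge0 => p _; apply: mulr_ge0.
  by apply/fintype.subsetP=> _ /imsetP[h /hS[h1 h2 _ _] ->]; apply/setXP.
move=> f atf fe; have [sf f0 H] := atomP atf; have [ff fb] := stableP _ _ sf.
have yf := ideal_ge ff fe f0.
exists 1%N; first by rewrite expn1.
rewrite (bigD1 0) /=; last by rewrite mul0r eqxx andbT; apply/stableP; rewrite mul0r rmorph0.
rewrite (big_pred1 f); last first.
  move=> g /=; apply/idP/eqP=> [/andP[/andP[sg /eqP gf] g0]|->]; first exact: H.
  by rewrite sf ff eqxx.
rewrite expr1 ideal0 cards1 /root4 !sqrtr1 invr1 lerD2l lef_pV2 ?posrE ?sqrtr_gt0 ?ltr0n //.
  by rewrite !ler_sqrt ?sqrtr_ge0 ?sqrtr_gt0 ?ltr0n ?ler_nat // (leq_trans y0).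
exact: leq_trans yf.
Qed.
End Counting.

Section RandomNorm.
Variables (A : finComNzRingType) (bar : {rmorphism A -> A}) (Q : nat).
Hypotheses (barK : involutive bar) (Q_gt2 : (2 < Q)%N).
Hypothesis expQ : forall a : A, a ^+ Q = a.
Variable e : A.
Hypothesis stable_e : stable bar e.
Hypothesis bar_nontriv : forall f, stable bar f -> f * e = f -> f != 0 ->
  exists x, bar x * f != x * f.
Implicit Types (a b c f g h u v w x : A).
Local Notation supp := (idsupp Q).
Local Notation pinv := (@pinv _ Q).
Local Notation units := (units Q).

Definition hull a := supp a + bar (supp a) - supp a * bar (supp a).

Lemma stable_hull a : stable bar (hull a).
Proof.
have ss := support_idem Q_gt2 expQ a.
have bb : bar (supp a) * bar (supp a) = bar (supp a) by rewrite -rmorphM ss.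
apply/stableP; split; last first.
  by rewrite rmorphB rmorphD rmorphM /= !barK (mulrC _ (supp a)) (addrC _ (supp a)).
rewrite /hull; set s := supp a in ss bb *; set r := bar s in bb *.
transitivity (s * s + r * r + s * r *+ 2 - (s * s) * r *+ 2 - s * (r * r) *+ 2 + (s * s) * (r
  * r)); first by ring.
by rewrite ss bb; ring.
Qed.

Lemma supp_hull a : supp a * hull a = supp a.
Proof. by rewrite mulrBr mulrDr mulrA !(support_idem Q_gt2 expQ); ring. Qed.

Lemma mul_hull a : a * hull a = a.
Proof.
by rewrite -{1}(mul_support Q_gt2 expQ a) -mulrA supp_hull (mul_support Q_gt2 expQ).
Qed.

Lemma hull_eq0 a : hull a = 0 -> a = 0.
Proof. by move=> h0; rewrite -[a]mul_hull h0 mulr0. Qed.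

Lemma hull_le a : a * e = a -> hull a * e = hull a.
Proof.
have [_ eb] := stableP _ _ stable_e.
move=> /(support_mull Q_gt2) se.
have be : bar (supp a) * e = bar (supp a) by rewrite -{1}eb -rmorphM se.
by rewrite !(mulrDl, mulNr) -mulrA be se.
Qed.

Lemma unitsP v : v \in units e -> [/\ v * e = v, bar v * e = bar v,
  v * pinv v = e & bar v * pinv (bar v) = e].
Proof.
have [ee eb] := stableP _ _ stable_e.
case/setIdP=> /idealP ve /eqP sv.
have bve : bar v * e = bar v by rewrite -{1}eb -rmorphM ve.
by rewrite !(mul_pinv Q_gt2) (support_bar bar) sv.
Qed.

Lemma units_card_solutions a b c : b * e = b -> b * bar b = - e ->
    a * e = a -> c * e = c ->
  let V := [set v in units e | c * bar v == a * b * v] in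
  (#|V| ^ 2 * #|ideal (hull a)| <= #|ideal e| ^ 2)%N /\ (V != set0 -> hull c = hull a).
Proof.
move=> be bN ae ce V; have [ee eb] := stableP _ _ stable_e.
have sbe : supp b = e.
  have E : supp b * bar (supp b) = e.
    by rewrite -support_bar -supportM bN support_opp // support_id.
  by rewrite -(support_mull Q_gt2 be) -{1}E mulrA (support_idem Q_gt2 expQ) E.
have [->|/set0Pn[v0 v0V]] := eqVneq V set0; first by rewrite cards0.
have [v0U /eqP v0E] := setIdP v0V; have [v0e bv0e v0i bv0i] := unitsP v0U.
split; last first.
  move=> _; have: supp (c * bar v0) = supp (a * b * v0) by rewrite v0E.
  rewrite !supportM support_bar sbe; case/setIdP: v0U => _ /eqP ->.
  by rewrite eb -mulrA ee !(support_mull Q_gt2) // /hull => ->.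
have [hh hb] := stableP _ _ (stable_hull a).
have hae := hull_le ae.
pose k := e - hull a; have sd : stable bar k by apply: stable_sub => //; apply: stable_hull.
have [dd db] := stableP _ _ sd.
have hd : hull a * k = 0 by rewrite mulrBr hae hh subrr.
have eE : hull a + k = e by rewrite /k; ring.
have cI : #|ideal e| = (#|ideal (hull a)| * #|ideal k|)%N.
  by rewrite -card_ideal_add // eE.
have cF := card_fixed Q_gt2 expQ bar_nontriv (stable_hull a) hae.
suff VF : (#|V| <= #|fixed bar (hull a)| * #|ideal k|)%N.
  rewrite cI; apply: (@leq_trans ((#|fixed bar (hull a)| * #|ideal k|) ^ 2 * #|ideal (hull
    a)|)).
    by rewrite leq_mul2r leq_exp2r // VF orbT.
  by rewrite !expnMn mulnAC leq_mul2r -(mulnn #|ideal (hull a)|) leq_mul2r cF !orbT.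
rewrite -cardsX -(@card_in_imset _ _ (fun v => (v * pinv v0 * hull a, v * k)) (mem V));
  last first.
  move=> v w /setIdP[/unitsP[ve _ _ _] _] /setIdP[/unitsP[we _ _ _] _] [E1 E2].
  rewrite -ve -we -eE (mulrDr v) (mulrDr w) E2; congr (_ + _).
  have K u : u * e = u -> u * pinv v0 * hull a * v0 = u * hull a.
    by move=> ue; rewrite mulrAC -(mulrA u) (mulrC (pinv _)) v0i ue.
  by rewrite -K // E1 K.
apply/subset_leq_card/fintype.subsetP=> _ /imsetP[v /setIdP[vU /eqP vE] ->].
have [ve bve vi bvi] := unitsP vU.
apply/setXP => /=; split; last by apply/idealP; rewrite -mulrA dd.
rewrite inE; apply/andP; split; first by apply/idealP; rewrite -mulrA hh.
have E1 : a * v * bar v0 = a * v0 * bar v.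
  have : a * e * v * bar v0 = a * e * v0 * bar v.
    rewrite -sbe -(mul_pinv Q_gt2).
    transitivity (a * b * v * (bar v0 * pinv b)); first by ring.
    rewrite -vE; transitivity (c * bar v0 * bar v * pinv b); first by ring.
    by rewrite v0E; ring.
  by rewrite ae.
pose w := v * pinv v0.
have E2 : a * w = a * bar w.
  have -> : a * w = a * v * bar v0 * (pinv v0 * pinv (bar v0)).
    transitivity (a * e * w); first by rewrite ae.
    by rewrite /w -bv0i; ring.
  rewrite E1; have -> : bar w = bar v * pinv (bar v0) by rewrite rmorphM /= rmorphXn.
  transitivity (a * e * (bar v * pinv (bar v0))); last by rewrite ae.
  by rewrite -v0i; ring.
have E3 : supp a * w = supp a * bar w.
  by rewrite -(mul_pinv Q_gt2) (mulrAC a (pinv a) w) (mulrAC a (pinv a)) E2.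
have E4 : bar (supp a) * w = bar (supp a) * bar w.
  by have := congr1 bar E3; rewrite (rmorphM bar _ w) (rmorphM bar _ (bar w)) barK => <-.
rewrite -/w rmorphM /= hb eq_sym; apply/eqP.
rewrite ![_ * hull a]mulrC /hull !(mulrDl, mulNr) E3 E4.
by rewrite -(mulrA (supp a)) E4 mulrA.
Qed.

Lemma root4_ge (T : rcfType) (m k : nat) :
  (m ^ 4 <= k)%N -> m%:R <= root4 k%:R :> T.
Proof.
move=> mk; have -> : m%:R = root4 (m%:R ^+ 4) :> T.
  by rewrite /root4 (exprM _ 2 2) sqrtr_sqr ger0_norm ?exprn_ge0 // sqrtr_sqr ger0_norm.
by rewrite /root4 !ler_wsqrtr // -natrX ler_nat.
Qed.

Lemma root4_gt0 (T : rcfType) (k : nat) : (0 < k)%N -> 0 < root4 k%:R :> T.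
Proof. by move=> k0; rewrite !sqrtr_gt0 ltr0n. Qed.

Lemma ideal_gt0 f : (0 < #|ideal f|)%N.
Proof. by apply/card_gt0P; exists 0; apply/idealP; rewrite mul0r. Qed.

Lemma root4X (T : rcfType) (k : nat) : root4 k%:R ^+ 4 = k%:R :> T.
Proof. by rewrite (exprM _ 2 2) !sqr_sqrtr ?sqrtr_ge0. Qed.

Lemma bernoulli (T : realDomainType) (t : T) m : -1 <= t ->
  1 + t * m%:R <= (1 + t) ^+ m.
Proof.
move=> t1; elim: m => [|m IH]; first by rewrite mulr0 addr0.
apply: (@le_trans _ _ ((1 + t) * (1 + t * m%:R))); last first.
  by rewrite exprS ler_wpM2l //; lra.
have : 0 <= t * t * m%:R by rewrite mulr_ge0 // -expr2 sqr_ge0.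
by rewrite -addn1 natrD; lra.
Qed.

(* Union bound over the elements v / bar v * b0 with v a random unit: a bad pair
   (a, c) whose hull is f is hit with probability at most |ideal f|^(-1/2), and
   there are at most |ideal f|^(1/4) such pairs. *)
Lemma exists_norm_avoiding (T : rcfType) (y N : nat) (bad : {set A * A}) :
  (2 < N)%N -> (N ^ 8 <= y)%N -> (#|ideal e| <= y ^ N)%N ->
  (forall f, f * f = f -> f * e = f -> f != 0 -> (y <= #|ideal f|)%N) ->
  (forall f, stable bar f -> f * e = f -> f != 0 ->
    (#|[set p in bad | ((p.1 * e)%R \in ideal f) && ((p.2 * e)%R \in ideal f)]| ^ 4 <=
      #|ideal f|)%N) ->
  exists b, [/\ b * e = b, b * bar b = - e
    & forall p, p \in bad -> p.2 * e = p.1 * b -> p.1 * e = 0].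
Proof.
move=> N2 Ny eN ideal_ge badP; have [ee eb] := stableP _ _ stable_e.
have [b0 b0e b0N] := norm_opp barK Q_gt2 expQ bar_nontriv stable_e ee.
pose V (p : A * A) := [set v in units e | (p.2 * e) * bar v == (p.1 * e) * b0 * v].
pose B := \bigcup_(p in [set p in bad | p.1 * e != 0]) V p.
suff ltBU : (#|B| < #|units e|)%N.
  have [v vU vB] : exists2 v, v \in units e & v \notin B.
    apply/exists_inP; rewrite -negb_forall_in; apply: contraL ltBU => /forall_inP H.
    by rewrite -leqNgt; apply/subset_leq_card/fintype.subsetP.
  have [ve bve vi bvi] := unitsP vU.
  exists (b0 * v * pinv (bar v)); split.
  - by rewrite -[in RHS]b0e; ring.
  - rewrite !rmorphM /= rmorphXn barK -/(pinv v).
    transitivity (b0 * bar b0 * (v * pinv v) * (bar v * pinv (bar v))); first by ring.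
    by rewrite vi bvi b0N mulNr ee mulNr ee.
  move=> p pbad pE; apply: contraNeq vB => p0; apply/bigcupP; exists p;
    first by rewrite inE pbad.
  rewrite inE vU pE; apply/eqP.
  transitivity (p.1 * b0 * v * (bar v * pinv (bar v))); first by ring.
  by rewrite bvi; ring.
have y0 : (0 < y)%N by apply: leq_trans Ny; rewrite expn_gt0 (ltn_trans _ N2).
have y1 : (1 < y)%N by apply: leq_trans Ny; rewrite (@leq_trans (2 ^ 8)) // leq_exp2r // ltnW.
set t : T := (root4 y%:R)^-1.
have tN : t * N%:R <= 3^-1.
  have h : (N ^ 2)%:R <= root4 y%:R :> T by apply: root4_ge; rewrite -expnM.
  rewrite mulrC -(ler_pM2r (root4_gt0 T y0)) /t mulfVK ?gt_eqF ?root4_gt0 //.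
  rewrite mulrC ler_pdivlMr // -natrM; apply: le_trans h.
  by rewrite ler_nat -mulnn leq_mul2l N2 orbT.
have t0 : 0 <= t by rewrite invr_ge0 sqrtr_ge0.
have t1 : t <= 1.
  by rewrite /t invf_le1 ?root4_gt0 // (root4_ge _ (m := 1)).
have kN k : (y ^ k <= #|ideal e|)%N -> (k <= N)%N.
  by move=> h; rewrite -(leq_exp2l _ _ y1) (leq_trans h).
have bern m : (m <= N)%N -> 2 / 3 <= (1 - t) ^+ m.
  move=> mN; apply: le_trans (bernoulli (t := - t) m _); last by lra.
  have : t * m%:R <= t * N%:R by rewrite ler_wpM2l // ler_nat.
  by rewrite mulNr; lra.
have [k /kN kleN Uk] : exists2 k, (y ^ k <= #|ideal e|)%N &
    (1 - t) ^+ k * #|ideal e|%:R <= #|units e|%:R.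
  apply: (card_units Q_gt2 expQ ideal_ge) => //; first by rewrite t0.
  rewrite mulrC ler_pdivlMr ?root4_gt0 // mul1r -{2}root4X.
  by rewrite ler_eXnr // (root4_ge _ (m := 1)).
have [l /kN lleN Zl] := sum_weight ideal_ge T y0 stable_e ee.
rewrite -(ltr_nat T).
set I : T := #|ideal e|%:R in Uk.
have I0 : 0 < I by rewrite ltr0n ideal_gt0.
apply: (@lt_le_trans _ _ (2 / 3 * I)); last first.
  by apply: le_trans Uk; rewrite ler_pM2r // bern.
apply: (@le_lt_trans _ _ (I / 2)); last by lra.
pose r f : T := root4 #|ideal f|%:R.
have r0 f : 0 < r f by apply/root4_gt0/ideal_gt0.
apply: (@le_trans _ _ (\sum_(f | stable bar f && (f * e == f) && (f != 0)) I / r f));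
  last first.
  rewrite -mulr_sumr ler_pM2l // -(lerD2l 1) (_ : 1 + 2^-1 = (2 / 3)^-1); last by field.
  apply: (@le_trans _ _ ((1 + t) ^+ l)).
    apply: le_trans Zl; rewrite [leRHS](bigD1 0) /=; last first.
      by rewrite mul0r eqxx andbT; apply/stableP; rewrite mul0r rmorph0.
    by rewrite ideal0 cards1 /root4 !sqrtr1 invr1.
  have b := bern l lleN; have bgt : 0 < (1 - t) ^+ l by lra.
  apply: (@le_trans _ _ ((1 - t) ^+ l)^-1); last by rewrite lef_pV2 // posrE; lra.
  rewrite -[leRHS]mul1r ler_pdivlMr // -exprMn exprn_ile1 //.
    by rewrite mulr_ge0 ?subr_ge0 ?addr_ge0 ?ler01.
  have : 0 <= t * t by rewrite mulr_ge0.
  by rewrite mulrDl mulrBr; lra.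
apply: (@le_trans _ _ (\sum_(p | (p \in bad) && (p.1 * e != 0)) #|V p|%:R)).
  rewrite -natr_sum ler_nat (eq_bigl (mem [set p in bad | p.1 * e != 0])); last by move=> p;
    rewrite !inE.
  rewrite /B; apply: (big_ind2 (fun (S : {set A}) m => (#|S| <= m)%N)) => [|S m S' m' h h'|//].
    by rewrite cards0.
  by apply: leq_trans (leq_add h h'); rewrite cardsU leq_subr.
have aeE a : a * e * e = a * e by rewrite -mulrA ee.
rewrite (partition_big (fun p => hull (p.1 * e))
  (fun f => stable bar f && (f * e == f) && (f != 0))) /=; last first.
  move=> p /andP[_ p0]; rewrite stable_hull hull_le //= eqxx /=.
  by apply: contraNneq p0 => /hull_eq0 ->.
apply: ler_sum => f /andP[/andP[sf /eqP fe] f0].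
set L := [set p in bad | (p.1 * e \in ideal f) && (p.2 * e \in ideal f)].
have Lr : #|L|%:R <= r f by apply: root4_ge; apply: badP.
have rE : #|ideal f|%:R = r f ^+ 4 by rewrite /r root4X.
apply: (@le_trans _ _ (\sum_(p in L) I / r f ^+ 2)).
  rewrite big_mkcond [leRHS]big_mkcond; apply: ler_sum => p _.
  have P0 : 0 <= I / r f ^+ 2 by rewrite divr_ge0 ?exprn_ge0 // ltW.
  case: ifP => [/andP[/andP[pbad p0] /eqP hf]|_]; last by case: ifP.
  have [VI Vh] := units_card_solutions b0e b0N (aeE p.1) (aeE p.2).
  rewrite -/(V p) hf in VI Vh.
  have VB : #|V p|%:R <= I / r f ^+ 2.
    rewrite -(ler_pXn2r (n := 2)) ?nnegrE //; rewrite expr_div_n -exprM -rE.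
    by rewrite ler_pdivlMr ?ltr0n ?ideal_gt0 // -!natrX -natrM ler_nat.
  case: ifP => // /negP pL; have [V0|/Vh hc] := eqVneq (V p) set0; first by rewrite V0 cards0.
  by case: pL; rewrite inE pbad;
    rewrite !inE -[X in _ * X == _]hf mul_hull eqxx -[X in _ * X == _]hc mul_hull eqxx.
rewrite sumr_const -mulr_natl; apply: (@le_trans _ _ (r f * (I / r f ^+ 2))).
  by rewrite ler_wpM2r // divr_ge0 ?exprn_ge0 // ltW.
by rewrite (_ : _ * _ = I / r f) //; field; rewrite gt_eqF.
Qed.
End RandomNorm.

(** * Group algebras of finite abelian groups *)

Section GroupAlgebraTheory.
Variables (F : finFieldType) (gT : finGroupType).
Local Notation FG := (grpalg F gT).
Implicit Types (a b c : FG) (x z : gT).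

Definition grpelt x : FG := [ffun z => (z == x)%:R].

Lemma grpelt_mulE x a z : (grpelt x * a) z = a (x^-1 * z)%g.
Proof.
rewrite ffunE (bigD1 x) //= ffunE eqxx mul1r big1 ?addr0 // => y /negPf yx.
by rewrite ffunE yx mul0r.
Qed.

Lemma grpeltM x z : grpelt (x * z)%g = grpelt x * grpelt z.
Proof. by apply/ffunP=> y;
  rewrite grpelt_mulE !ffunE eq_sym (can2_eq (mulKg x) (mulKVg x)) eq_sym. Qed.

Lemma grpelt1 : grpelt 1%g = 1.
Proof. by apply/ffunP=> y; rewrite !ffunE. Qed.

Lemma grpeltX x k : grpelt (x ^+ k)%g = grpelt x ^+ k.
Proof. by elim: k => [|k IH]; rewrite ?grpelt1 // expgS grpeltM IH exprS. Qed.

Lemma grpelt_decomp a : a = \sum_x a x *: grpelt x.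
Proof.
apply/ffunP=> z; rewrite sum_ffunE (bigD1 z) //= big1 => [|x /negPf xz].
  by rewrite !ffunE eqxx addr0; exact/esym/mulr1.
by rewrite !ffunE eq_sym xz; exact: mulr0.
Qed.

Hypothesis abG : abelian [set: gT].

Let mgC x z : (x * z = z * x)%g.
Proof. by apply: (centsP abG); rewrite inE. Qed.

Lemma grpalg_mulC : commutative (@GRing.mul FG).
Proof.
move=> a b; apply/ffunP=> z; rewrite !ffunE.
rewrite (reindex_inj (mulgI z)) (reindex_inj invg_inj) /=.
by apply: eq_bigr => x _; rewrite mulrC invMg invgK -mulgA mulVg mulg1 mgC.
Qed.

Definition comGrpalg : finComNzRingType :=
  HB.pack FG (GRing.PzSemiRing_hasCommutativeMul.Build FG grpalg_mulC).

Definition grpalg_bar (a : comGrpalg) : comGrpalg := [ffun x => (a : FG) x^-1%g].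

Lemma grpalg_bar_is_zmod_morphism : zmod_morphism grpalg_bar.
Proof. by move=> a b; apply/ffunP=> x; rewrite !ffunE. Qed.

Lemma grpalg_bar_is_monoid_morphism : monoid_morphism grpalg_bar.
Proof.
split=> [|a b]; first by apply/ffunP=> x; rewrite !ffunE eq_invg1.
apply/ffunP=> z; rewrite !ffunE [RHS](reindex_inj invg_inj) /=.
by apply: eq_bigr => x _; rewrite !ffunE !invgK invMg mgC.
Qed.

HB.instance Definition _ := GRing.isZmodMorphism.Build comGrpalg comGrpalg
  grpalg_bar grpalg_bar_is_zmod_morphism.
HB.instance Definition _ := GRing.isMonoidMorphism.Build comGrpalg comGrpalg
  grpalg_bar grpalg_bar_is_monoid_morphism.
Local Notation bar := (grpalg_bar : {rmorphism comGrpalg -> comGrpalg}).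

Lemma grpalg_barK : involutive bar.
Proof. by move=> a; apply/ffunP=> x; rewrite !ffunE invgK. Qed.

Lemma bar_grpelt x : bar (grpelt x) = grpelt x^-1%g.
Proof. by apply/ffunP=> z; rewrite !ffunE; congr ((_ : bool)%:R); rewrite -eq_invg_sym. Qed.

Lemma inner_bar (u v : grpalg2 F gT) :
  inner u v = (u.1 * bar v.1 + u.2 * bar v.2 : FG) 1%g.
Proof.
rewrite !ffunE -big_split /=; apply: eq_bigr => x _.
by rewrite !ffunE mulg1 invgK.
Qed.

Hypotheses (oddG : odd #|gT|) (coGq : coprime #|gT| #|F|) (G_gt1 : (1 < #|gT|)%N).
Local Notation q := #|F|.
Local Notation n := #|gT|.
Local Notation A := comGrpalg.

Lemma grpelt_cardX x k : (k = 1 %[mod n])%N -> grpelt x ^+ k = grpelt x.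
Proof.
move=> k1; rewrite -grpeltX; congr grpelt.
have xn : (x ^+ n = 1)%g by rewrite -cardsT expg_cardG // inE.
by rewrite -(expg_mod k xn) k1 expg_mod // expg1.
Qed.

Lemma pchar_grpalg_nat : [pchar A].-nat q.
Proof.
have [p p_pr pF] := finPcharP F.
have pA : p \in [pchar A].
  rewrite inE p_pr /=; apply/eqP.
  have -> : p%:R = p%:R *: (1 : FG) :> FG by rewrite scaler_nat.
  by rewrite (pcharf0 pF) scale0r.
have qp := card_pprimeChar pF.
rewrite [q]qp pnatX (eq_pnat _ (pcharf_eq pA)) pnat_id ?orbT //.
Qed.

Lemma expr_frobenius a k : (a : A) ^+ (q ^ k) = \sum_x a x *: (grpelt x) ^+ (q ^ k).
Proof.
have qk : [pchar A].-nat (q ^ k)%N by rewrite pnatX pchar_grpalg_nat.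
have -> : (a : A) ^+ (q ^ k) = (\sum_x a x *: grpelt x : A) ^+ (q ^ k) by rewrite
  -grpelt_decomp.
rewrite (big_morph (fun b : A => b ^+ (q ^ k)) (id1 := 0) (op1 := +%R)); last first.
- by rewrite expr0n expn_eq0; have := card_finNzRing_gt1 F; case: q => [|[]].
- by move=> b c; apply: exprDn_pchar.
apply: eq_bigr => x _; rewrite -[LHS]/((a x *: grpelt x : FG) ^+ (q ^ k)) exprZn.
congr (_ *: _); elim: k {qk} => // k IH.
by rewrite expnS exprM expf_card.
Qed.

(* The factor 2 only serves to make the exponent exceed 2. *)
Definition perfect_exp := (q ^ (2 * totient n))%N.

Lemma perfect_exp_gt2 : (2 < perfect_exp)%N.
Proof.
have q2 := card_finNzRing_gt1 F; have n0 : (0 < n)%N by apply: ltnW.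
apply: (@leq_trans (2 ^ 2)) => //; apply: (@leq_trans (q ^ 2)); first by rewrite leq_exp2r.
by rewrite leq_pexp2l ?(ltnW q2) // leq_pmulr // totient_gt0.
Qed.

Lemma expr_perfect (a : A) : a ^+ perfect_exp = a.
Proof.
rewrite expr_frobenius [RHS]grpelt_decomp; apply: eq_bigr => x _.
rewrite grpelt_cardX // mulnC expnM -modnXm Euler_exp_totient 1?coprime_sym //.
by rewrite modnXm exp1n.
Qed.

Definition grpalg_avg : FG := [ffun=> n%:R^-1].

Lemma card_neq0 : n%:R != 0 :> F.
Proof.
have [p p_pr pF] := finPcharP F; rewrite -(dvdn_pcharf pF).
have pq : (p %| q)%N.
  have := card_finNzRing_gt1 F; rewrite [q](card_pprimeChar pF : q = _).
  by case: (logn _ _) => // k _; apply: dvdn_exp.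
by apply: contraL coGq => pn; apply/negP => /(coprime_dvdl pn); rewrite prime_coprime ?pq.
Qed.

Lemma avg_mul a : grpalg_avg * a = (n%:R^-1 * \sum_x a x) *: [ffun=> 1].
Proof.
apply/ffunP=> z; rewrite !ffunE -[RHS]/(_ * _) mulr1 mulr_sumr.
rewrite (reindex_inj (mulgI z)) (reindex_inj invg_inj) /=.
by apply: eq_bigr => x _; rewrite ffunE invMg invgK -mulgA mulVg mulg1.
Qed.

Lemma avg_fixed a : (forall x, grpelt x * a = a) -> grpalg_avg * a = a.
Proof.
move=> H; have aE x : a x = a 1%g.
  by rewrite -[in RHS](H x^-1%g) grpelt_mulE invgK mulg1.
apply/ffunP=> z; rewrite avg_mul !ffunE -[LHS]/(_ * _) mulr1.
under eq_bigr do rewrite aE.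
by rewrite sumr_const -[a 1%g *+ _]mulr_natl mulrA mulVf ?card_neq0 // mul1r aE.
Qed.

Lemma grpelt_avg x : grpelt x * grpalg_avg = grpalg_avg.
Proof. by apply/ffunP=> z; rewrite grpelt_mulE !ffunE. Qed.

Lemma stable_avg : stable bar grpalg_avg.
Proof.
apply/stableP; split; last by apply/ffunP=> x; rewrite !ffunE.
by apply: avg_fixed; apply: grpelt_avg.
Qed.

Definition grpalg_aug : A := 1 - (grpalg_avg : A).

Lemma stable_aug : stable bar grpalg_aug.
Proof.
have [aa ab] := stableP _ _ stable_avg.
apply: stable_sub stable_avg _; last exact: mulr1.
by apply/stableP; rewrite mulr1 rmorph1.
Qed.

Lemma mul_avg_aug : (grpalg_avg : A) * grpalg_aug = 0.
Proof. by have [aa _] := stableP _ _ stable_avg; rewrite mulrBr mulr1 aa subrr. Qed.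

Lemma aug_fixed (f : A) : f * grpalg_aug = f -> (forall x, grpelt x * f = f) -> f = 0.
Proof.
move=> fa H; have E : (grpalg_avg : A) * f = f := avg_fixed H.
by rewrite -fa -E mulrAC mul_avg_aug mul0r.
Qed.

Lemma bar_nontrivial f : stable bar f -> f * grpalg_aug = f -> f != 0 ->
  exists a : A, bar a * f != a * f.
Proof.
move=> sf fa f0; have [/existsP[x xf]|] := boolP [exists x, bar (grpelt x) * f != (grpelt x :
  A) * f].
  by exists (grpelt x).
rewrite negb_exists => /forallP H; case/eqP: f0; apply: aug_fixed => // x.
have H2 z : grpelt (z * z)%g * f = f.
  have /negPn/eqP := H z; rewrite bar_grpelt => E.
  rewrite grpeltM -[LHS]mulrA -[X in _ * X]/((grpelt z : A) * f) -E.
  by rewrite -[LHS]/(grpelt z * (grpelt z^-1%g * f)) mulrA -grpeltM mulgV grpelt1 mul1r.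
have -> : x = (x ^+ (n.+1)./2 * x ^+ (n.+1)./2)%g; last exact: H2.
rewrite -expgD addnn; have -> : ((n.+1)./2).*2 = n.+1 by have := odd_double_half n.+1;
  rewrite /= oddG.
by rewrite expgS -cardsT expg_cardG ?inE // mulg1.
Qed.
End GroupAlgebraTheory.

(** * Cyclotomic cosets *)

Section MinimalCoset.
Variables (q n : nat).
Hypothesis n_gt1 : (1 < n)%N.
Local Notation coset := (@cyclotomic_coset q n).

Lemma nontrivial_coset (x : 'Z_n) : x != 0 -> coset x \in nontrivial_cosets q n.
Proof.
move=> x0; rewrite inE; apply/andP; split; first by apply/imsetP; exists x.
apply: contraNneq x0 => E; have : x \in coset x by rewrite inE -fconnect_orbit connect0.
by rewrite E inE.
Qed.

Lemma mu_arg : exists2 x : 'Z_n, mu q n = #|coset x| &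
  forall z : 'Z_n, z != 0 -> (mu q n <= #|coset z|)%N.
Proof.
rewrite /mu; case: arg_minnP => [|B]; first exact/nontrivial_coset/oner_neq0.
rewrite inE => /andP[/imsetP[x _ ->] _] H; exists x => // z z0.
exact/H/nontrivial_coset.
Qed.

Lemma mu_gt0 : (0 < mu q n)%N.
Proof.
have [x -> _] := mu_arg; apply/card_gt0P; exists x.
by rewrite inE -fconnect_orbit connect0.
Qed.

Lemma mu_le_modulus : (mu q n <= n)%N.
Proof.
have [x -> _] := mu_arg; apply: leq_trans (max_card _) _.
by rewrite card_ord Zp_cast.
Qed.

(* With r = gcd(n, q^d - 1) > 1, the coset of n / r has at most d elements. *)
Lemma mu_le d : (0 < d)%N -> (0 < q)%N -> (1 < gcdn n (q ^ d - 1))%N ->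
  (mu q n <= d)%N.
Proof.
move=> d0 q0; set r := gcdn _ _ => r1.
have n0 : (0 < n)%N := ltnW n_gt1; have r0 : (0 < r)%N := ltnW r1.
have rn : (r %| n)%N := dvdn_gcdl _ _.
have nrn : ((n %/ r) * r = n)%N by rewrite divnK.
pose z : 'Z_n := (n %/ r)%:R.
have zE : z = (n %/ r)%N :> nat by rewrite val_Zp_nat // modn_small // ltn_Pdiv.
have z0 : z != 0 by rewrite -val_eqE /= zE -lt0n divn_gt0 // dvdn_leq.
have [_ _ /(_ z z0) /leq_trans] := mu_arg; apply.
pose f (z : 'Z_n) := q%:R * z.
have fX k : iter k f z = (q ^ k)%:R * z.
  by elim: k => [|k IH]; rewrite ?mul1r //= IH /f mulrA -natrM -expnS.
have fz : iter d f z = z.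
  have nn0 : n%:R = 0 :> 'Z_n by rewrite -Zp_nat_mod // modnn.
  have dE : (q ^ d = (q ^ d - 1) %/ r * r + 1)%N.
    by rewrite divnK ?dvdn_gcdr // subnK // expn_gt0 q0.
  rewrite fX dE natrD mulrDl mul1r natrM -mulrA -[r%:R * z]natrM mulnC nrn nn0.
  by rewrite mulr0 add0r.
have fdz j : iter (j * d) f z = z by elim: j => // j IH; rewrite mulSn iterD IH fz.
have sub : coset z \subset [set iter (i : 'I_d) f z | i : 'I_d].
  apply/fintype.subsetP=> w; rewrite inE -fconnect_orbit => /iter_findex <-.
  set k := findex _ _ _; apply/imsetP; exists (Ordinal (ltn_pmod k d0)) => //=.
  by rewrite {1}(divn_eq k d) addnC iterD fdz.
apply: leq_trans (subset_leq_card sub) _.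
by apply: leq_trans (leq_imset_card _ _) _; rewrite card_ord.
Qed.
End MinimalCoset.

(** * Words of low weight *)

Section InformationSets.
Variables (F : finFieldType) (gT : finGroupType).
Local Notation FG := (grpalg F gT).
Variable I : {set FG}.
Hypotheses (I0 : 0 \in I) (ID : {in I &, forall a b, a + b \in I})
  (IZ : forall k, {in I, forall a, k *: a \in I}).
Implicit Types (a b : FG) (J : {set gT}).

Definition separating J := [forall a in I, [forall x in J, a x == 0] ==> (a == 0)].

Lemma separatingP J : reflect (forall a, a \in I -> (forall x, x \in J -> a x = 0) -> a = 0)
  (separating J).
Proof.
apply: (iffP forall_inP) => [H a aI a0|H a aI].
  apply/eqP; apply: (implyP (H a aI)).
  by apply/forall_inP=> x xJ; apply/eqP/a0.
by apply/implyP=> /forall_inP a0; apply/eqP/H => // x /a0/eqP.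
Qed.

Definition restrict J a : {ffun gT -> F} := [ffun x => if x \in J then a x else 0].

Lemma restrict_pffun J a : restrict J a \in pffun_on 0 (mem J) predT.
Proof.
apply/pffun_onP; split=> //; apply/fintype.subsetP=> x; rewrite inE ffunE.
by case: ifP => //; rewrite eqxx.
Qed.

Lemma restrict_inj J : separating J -> {in I &, injective (restrict J)}.
Proof.
move=> /separatingP sepJ a b aI bI E; apply/eqP; rewrite -subr_eq0; apply/eqP.
apply: sepJ => [|x xJ]; first by rewrite -scaleN1r ID ?IZ.
by have /ffunP/(_ x) := E; rewrite !ffunE xJ => ->; rewrite subrr.
Qed.

Lemma information_set : exists2 J, separating J & #|I| = (#|F| ^ #|J|)%N.
Proof.
have sepT : separating setT.
  by apply/separatingP=> a _ H; apply/ffunP=> x; rewrite H ?inE // ffunE.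
have [J /minsetP[sepJ minJ] _] := minset_exists sepT.
exists J => //; apply/eqP; rewrite -[(#|F| ^ _)%N](card_pffun_on 0 (mem J) predT) eqn_leq.
apply/andP; split.
  rewrite -(card_in_imset (restrict_inj sepJ)).
  by apply/subset_leq_card/fintype.subsetP=> _ /imsetP[a _ ->]; apply: restrict_pffun.
have /fin_all_exists[u uP] (j : gT) : exists a, j \in J ->
    [/\ a \in I, a j = 1 & forall x, x \in J -> x != j -> a x = 0].
  have [jJ|_] := boolP (j \in J); last by exists 0.
  have : ~~ separating (J :\ j).
    apply: contraL jJ => /minJ/(_ (subD1set _ _)) <-; by rewrite !inE eqxx.
  rewrite negb_forall_in => /exists_inP[a aI]; rewrite negb_imply => /andP[/forall_inP aJ a0].
  have aj : a j != 0.
    apply: contra a0 => /eqP aj; apply/eqP; apply: (separatingP _ sepJ) => // x xJ.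
    by have [->//|xj] := eqVneq x j; apply/eqP/aJ; rewrite !inE xj.
  exists ((a j)^-1 *: a) => _; split; first exact: IZ.
    by rewrite ffunE; exact: mulVf.
  move=> x xJ xj; rewrite ffunE (_ : a x = 0) ?scaler0 //.
  by apply/eqP/aJ; rewrite !inE xj.
pose comb (c : {ffun gT -> F}) : FG := \sum_(j in J) c j *: u j.
have combE c x : x \in J -> comb c x = c x.
  move=> xJ; rewrite sum_ffunE (bigD1 x) //= big1 ?addr0.
    by rewrite ffunE; have [_ -> _] := uP x xJ; exact: mulr1.
  move=> j /andP[jJ jx]; rewrite ffunE; have [_ _ ->] := uP j jJ; rewrite ?scaler0 //.
  by rewrite eq_sym.
rewrite -(@card_in_imset _ _ comb).
  apply/subset_leq_card/fintype.subsetP=> _ /imsetP[c _ ->].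
  by apply: (big_ind (fun a => a \in I)) => // j jJ; apply: IZ; case: (uP j jJ).
move=> c d /pffun_onP[cJ _] /pffun_onP[dJ _] E; apply/ffunP=> x.
have [xJ|xJ] := boolP (x \in J); first by rewrite -(combE c) // E combE.
have z (f : {ffun gT -> F}) : 0.-support f \subset J -> f x = 0.
  by move/fintype.subsetP/(_ x)/contra => /(_ xJ); rewrite inE negbK => /eqP.
by rewrite !z.
Qed.

Variables (T : realFieldType) (J : {set gT}).
Hypothesis sepJ : separating J.
Definition wt_on a := #|[set x in J | a x != 0]|.

Lemma sum_wt_on (s : T) : 0 <= s ->
  \sum_(a in I) s ^+ wt_on a <= (1 + #|F|%:R * s) ^+ #|J|.
Proof.
move=> s0; pose g (c : F) : T := if c == 0 then 1 else s.
have g0 c : 0 <= g c by rewrite /g; case: ifP.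
have gE a : s ^+ wt_on a = \prod_(x in J) g (restrict J a x).
  rewrite (bigID (fun x => a x == 0)) /= big1 ?mul1r => [|x /andP[xJ /eqP ax]].
    rewrite (eq_bigr (fun=> s)) => [|x /andP[xJ /negPf ax]]; last by rewrite ffunE xJ /g ax.
    by rewrite prodr_const; congr (_ ^+ _); apply: eq_card => x; rewrite !inE.
  by rewrite ffunE xJ /g ax eqxx.
under eq_bigr do rewrite gE.
rewrite -(big_imset (fun c : {ffun gT -> F} => \prod_(x in J) g (c x)) (restrict_inj sepJ)) /=.
apply: (@le_trans _ _ (\sum_(c in pffun_on 0 (mem J) predT) \prod_(x in J) g (c x))).
  rewrite big_mkcond [leRHS]big_mkcond; apply: ler_sum => c _.
  have P0 : 0 <= \prod_(x in J) g (c x) by apply: prodr_ge0.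
  case: ifP => [/imsetP[a _ ->]|_]; first by rewrite restrict_pffun.
  by case: ifP.
rewrite -(big_distr_big 0 (mem J) predT (fun _ => g)) /= prodr_const.
apply: lerXn2r; rewrite ?nnegrE ?sumr_ge0 ?addr_ge0 ?mulr_ge0 //.
rewrite (bigD1 0) //= /g eqxx lerD2l; under eq_bigr => c /negPf -> do [].
rewrite sumr_const -[leLHS]mulr_natl ler_wpM2r // ler_nat; exact: max_card.
Qed.

Variables (s k : T) (D : nat).
Hypotheses (s_gt0 : 0 < s) (skD : 1 <= s * k ^+ D) (sk : 1 + #|F|%:R * s <= k).

Lemma card_low_on :
  #|[set p in setX I I | (D * (wt_on p.1 + wt_on p.2) <= 2 * #|J|)%N]|%:R <= k ^+ (4 * #|J|).
Proof.
have s0 := ltW s_gt0.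
have k1 : 1 <= k by apply: le_trans sk; rewrite lerDl mulr_ge0.
have k0 : 0 <= k by apply: le_trans k1.
set L := [set p in _ | _].
apply: (@le_trans _ _ (\sum_(p in setX I I) k ^+ (2 * #|J|) * (s ^+ wt_on p.1 * s ^+ wt_on
  p.2))).
  rewrite -sum1_card natr_sum big_mkcond [leRHS]big_mkcond; apply: ler_sum => p _ /=.
  have P0 : 0 <= k ^+ (2 * #|J|) * (s ^+ wt_on p.1 * s ^+ wt_on p.2).
    by rewrite !mulr_ge0 ?exprn_ge0.
  case: ifP => [/setIdP[-> low]|_]; last by case: ifP.
  rewrite -exprD; set w := (_ + _)%N in low *.
  apply: (@le_trans _ _ (k ^+ (D * w) * s ^+ w)).
    by rewrite exprM -exprMn mulrC exprn_ege1.
  by rewrite ler_wpM2r ?exprn_ge0 // ler_weXn2l.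
rewrite -mulr_sumr (eq_bigl (fun p => (p.1 \in I) && (p.2 \in I))); last by move=> -[a b];
  rewrite in_setX.
rewrite -(pair_big (mem I) (mem I) (fun a b => s ^+ wt_on a * s ^+ wt_on b)) /=.
under eq_bigr do rewrite -mulr_sumr.
rewrite -mulr_suml (_ : 4 * #|J| = 2 * #|J| + 2 * #|J|)%N; last by rewrite -mulnDl.
rewrite exprD ler_wpM2l ?exprn_ge0 // [(2 * _)%N]mulnC exprM expr2.
have S0 : 0 <= \sum_(a in I) s ^+ wt_on a by apply: sumr_ge0 => a _; rewrite exprn_ge0.
have Sk : \sum_(a in I) s ^+ wt_on a <= k ^+ #|J|.
  apply: (le_trans (sum_wt_on s0)).
  by apply: lerXn2r; rewrite ?nnegrE // addr_ge0 // mulr_ge0.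
by apply: ler_pM.
Qed.

Hypothesis I_trans : forall x, {in I, forall a, grpelt F x * a \in I}.

Lemma sum_wt_on_translates a :
  (\sum_x wt_on (grpelt F x * a)%R = #|J| * #|[pred x | a x != 0%R]|)%N.
Proof.
under eq_bigr do rewrite /wt_on -sum1dep_card big_mkcondr.
rewrite exchange_big /= -sum_nat_const; apply: eq_bigr => z _.
rewrite (reindex_inj (mulgI z)) (reindex_inj invg_inj) /= -sum1_card [RHS]big_mkcond.
by apply: eq_bigr => x _; rewrite grpelt_mulE invMg invgK -mulgA mulVg mulg1 inE.
Qed.

(* Averaging over translates: a low weight word has low weight on some
   translate of the information set J. *)
Lemma card_low_weight :
  #|[set p in setX I I | (D * hweight (p : grpalg2 F gT) <= code_length gT)%N]|%:R
    <= #|gT|%:R * k ^+ (4 * #|J|).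
Proof.
set L := [set p in _ | _].
pose M := [set p in setX I I | (D * (wt_on p.1 + wt_on p.2) <= 2 * #|J|)%N].
pose tr x (p : FG * FG) := (grpelt F x * p.1, grpelt F x * p.2).
have tr_inj x : injective (tr x).
  move=> [a b] [c d] [E1 E2].
  have K e : grpelt F x^-1%g * (grpelt F x * e) = e by rewrite mulrA -grpeltM mulVg grpelt1
    mul1r.
  by rewrite -(K a) -(K b) E1 E2 !K.
have sub : L \subset \bigcup_x tr x @^-1: M.
  apply/fintype.subsetP=> p /setIdP[pI low]; apply/bigcupP.
  suff /existsP[x xP] : [exists x, (D * (wt_on (tr x p).1 + wt_on (tr x p).2) <= 2 * #|J|)%N].
    exists x => //; rewrite !inE /= xP andbT.
    by case: p pI {low xP} => a b /setXP[/= aI bI]; rewrite !I_trans.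
  rewrite -[X in is_true X]negbK negb_exists; apply/negP => /forallP H.
  have : (\sum_(x : gT) (2 * #|J|).+1 <= \sum_(x : gT) D * (wt_on (tr x p).1 + wt_on (tr x
    p).2))%N.
    by apply: leq_sum => x _; rewrite ltnNge.
  rewrite -big_distrr big_split /= !sum_wt_on_translates -mulnDr sum_nat_const.
  rewrite -/(hweight (p : grpalg2 F gT)) mulnCA leqNgt => /negP; apply.
  apply: (@leq_ltn_trans (#|J| * code_length gT)); first by rewrite leq_mul2l low orbT.
  have n0 : (0 < #|gT|)%N by apply/card_gt0P; exists 1%g.
  by rewrite /code_length mulnC mulnAC mulnC mulnS -[X in (X < _)%N]add0n ltn_add2r.
apply: (@le_trans _ _ (#|gT|%:R * #|M|%:R)); last by rewrite ler_wpM2l // card_low_on.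
rewrite -natrM ler_nat; apply: leq_trans (subset_leq_card sub) _.
rewrite -sum_nat_const; apply: (big_ind2 (fun (S : {set FG * FG}) m => #|S| <= m)%N).
- by rewrite cards0.
- move=> S m S' m' h h'; apply: leq_trans (leq_add h h').
  by rewrite cardsU leq_subr.
by move=> x _; rewrite card_preimset.
Qed.
End InformationSets.

(** * Norms avoiding words of low weight *)

Section GoodUnits.
Variables (F : finFieldType) (gT : finGroupType).
Hypothesis abG : abelian [set: gT].
Hypotheses (oddG : odd #|gT|) (coGq : coprime #|gT| #|F|) (G_gt1 : (1 < #|gT|)%N).
Local Notation q := #|F|.
Local Notation n := #|gT|.
Local Notation FG := (grpalg F gT).
Local Notation A := (comGrpalg F abG).
Local Notation bar := (grpalg_bar (F := F) (abG := abG) : {rmorphism A -> A}).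
Local Notation avg := (grpalg_avg F gT : A).
Local Notation aug := (grpalg_aug F abG).

Let Q_gt2 : (2 < perfect_exp F gT)%N. Proof. exact: perfect_exp_gt2. Qed.
Let expQ (a : A) : a ^+ perfect_exp F gT = a. Proof. exact: expr_perfect. Qed.
Let bnt (f : A) : stable bar f -> f * aug = f -> f != 0 -> exists a : A, bar a * f != a * f.
Proof. exact: bar_nontrivial. Qed.
Let stab_avg : stable bar avg. Proof. exact: stable_avg. Qed.
Let stab_aug : stable bar aug. Proof. exact: stable_aug. Qed.

Section Ideal.
Variable f : A.
Local Notation I := (ideal f : {set FG}).

Lemma ideal_zero : (0 : FG) \in I.
Proof. by apply/(idealP (0 : A) f); rewrite mul0r. Qed.

Lemma ideal_add : {in I &, forall a b : FG, a + b \in I}.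
Proof.
move=> a b /(idealP (a : A) f) aI /(idealP (b : A) f) bI.
by apply/(idealP ((a : A) + b) f); rewrite mulrDl aI bI.
Qed.

Lemma ideal_mull (c : FG) : {in I, forall a : FG, c * a \in I}.
Proof.
move=> a /(idealP (a : A) f) aI.
by apply/(idealP ((c : A) * a) f); rewrite -mulrA aI.
Qed.

Lemma ideal_scale k : {in I, forall a : FG, k *: a \in I}.
Proof. by move=> a /(@ideal_mull k%:A); rewrite -scalerAl mul1r. Qed.

Lemma card_ideal_pow : exists d, #|ideal f| = (q ^ d)%N.
Proof.
by have [J _ ->] := information_set ideal_zero ideal_add ideal_scale; exists #|J|.
Qed.
End Ideal.

(* Lagrange's theorem for the unit group of the field [ideal f]. *)
Lemma expr_card_atom (f z : A) : atom idfun f -> z * f = z -> z != 0 ->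
  z ^+ #|ideal f| = z.
Proof.
move=> atf zf z0; have [/stableP[ff _] f0 _] := atomP atf.
have supp1 w : w * f = w -> w != 0 -> idsupp (perfect_exp F gT) w = f.
  by move=> wf w0; apply: (atom_support_fixed Q_gt2 expQ atf).
have I0 : 0 \in ideal f by apply/idealP; rewrite mul0r.
have zi : z * pinv (perfect_exp F gT) z = f by rewrite mul_pinv // supp1.
pose P := \prod_(v in ideal f :\ 0) v.
have zK v : v * f = v -> pinv (perfect_exp F gT) z * (z * v) = v.
  by move=> vf; rewrite mulrA (mulrC _ z) zi mulrC.
have z_inj : {in ideal f :\ 0 &, injective (fun v : A => z * v)}.
  move=> v w /setD1P[_ /(idealP (v : A) f) vf] /setD1P[_ /(idealP (w : A) f) wf] E.
  by rewrite -(zK v vf) E zK.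
have zI : [set z * v | v in ideal f :\ 0] = ideal f :\ 0.
  apply/eqP; rewrite eqEcard card_in_imset // leqnn andbT.
  apply/fintype.subsetP=> _ /imsetP[v /setD1P[v0 /(idealP (v : A) f) vf] ->].
  apply/setD1P; split; last by apply/(idealP (z * v) f); rewrite -mulrA vf.
  by apply: contraNneq v0 => zv; rewrite -(zK v vf) zv mulr0.
have PE : z ^+ #|ideal f :\ 0| * P = P.
  rewrite -prodr_const -big_split /= /P -[in RHS]zI.
  exact/esym/(big_imset (fun v : A => v)).
have Pf : f * idsupp (perfect_exp F gT) P = f.
  apply: (big_ind (fun v => f * idsupp (perfect_exp F gT) v = f)).
  - by rewrite /idsupp expr1n mulr1.
  - by move=> v w h1 h2; rewrite supportM mulrA h1.
  by move=> v /setD1P[v0 /(idealP (v : A) f) vf]; rewrite supp1.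
rewrite (cardsD1 (0 : A) (ideal f)) I0 exprS; set m := #|_| in PE *.
have zmf : z ^+ m * f = f; last by rewrite -{1}zf -mulrA (mulrC f) zmf.
by rewrite -{1}Pf -mul_pinv // mulrCA (mulrA (z ^+ m)) PE mul_pinv.
Qed.

Lemma ideal_ge (f : A) : f * f = f -> f * aug = f -> f != 0 ->
  (q ^ mu q n <= #|ideal f|)%N.
Proof.
have q1 := card_finNzRing_gt1 F.
move=> ff fa; have {ff} : stable idfun f by apply/stableP.
move: f fa => f0 fa0 sf0; move: f0 sf0 fa0.
apply: (@stable_ind A idfun aug (fun f => f != 0 -> (q ^ mu q n <= #|ideal f|)%N)).
- by rewrite eqxx.
- move=> f g /stableP[ff _] /stableP[gg _] fg _ _ IHf IHg fg0.
  rewrite card_ideal_add //; have [f0|f0] := eqVneq f 0.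
    rewrite f0 add0r in fg0; apply: leq_trans (IHg fg0) _.
    by rewrite leq_pmull // ideal_gt0.
  by apply: leq_trans (IHf f0) _; rewrite leq_pmulr // ideal_gt0.
move=> f atf fa f0; have [d cf] := card_ideal_pow f.
have [/stableP[ff _] _ _] := atomP atf.
have fX k : f ^+ k.+1 = f by elim: k => // k IH; rewrite exprS IH.
have d0 : (0 < d)%N.
  have : (1 < q ^ d)%N.
    rewrite -cf (cardsD1 (0 : A)) (_ : 0 \in _); last by apply/(idealP (0 : A) f);
      rewrite mul0r.
    rewrite add1n ltnS; apply/card_gt0P; exists f; apply/setD1P; split=> //.
    by apply/(idealP f f).
  by case: (d).
rewrite cf leq_exp2l //; apply: mu_le => //; first exact: ltnW.
have [/existsP[x xf]|/negbTE H] := boolP [exists x : gT, (grpelt F x : A) * f != f]; last first.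
  case/eqP: f0; apply: (aug_fixed coGq fa) => x; apply/eqP.
  by apply: contraFT H => xf; apply/existsP; exists x.
pose B k : A := grpelt F (x ^+ k)%g.
have BD k l : B (k + l)%N = B k * B l by rewrite /B expgD grpeltM.
have B1 : B 0 = 1 by rewrite /B expg0 grpelt1.
have fixM k l : B k * f = f -> B (k * l)%N * f = f.
  by move=> h; elim: l => [|l IH]; rewrite ?muln0 ?B1 ?mul1r // mulnS BD -mulrA IH.
have Bn : B n = 1 by rewrite /B -cardsT expg_cardG ?inE // grpelt1.
have BV k l : (k + l)%N = n -> B k * B l = 1 by rewrite -BD => ->.
have n0 : (0 < n)%N := ltnW G_gt1.
have Bx : B n.-1 * B 1 = 1 by apply: BV; rewrite addn1 prednK.
have qd0 : (0 < q ^ d)%N by rewrite expn_gt0 ltnW.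
have [m mE] : exists m, (q ^ d = m.+1)%N by exists (q ^ d).-1; rewrite prednK.
rewrite mE subn1 /=; have fixq : B m * f = f.
  have z0 : B 1 * f != 0.
    by apply: contraNneq f0 => E; rewrite -[f]mul1r -Bx -mulrA E mulr0.
  have := expr_card_atom atf _ z0; rewrite -mulrA ff => /(_ erefl).
  have BX k : B 1 ^+ k = B k by rewrite /B expg1 grpeltX.
  rewrite cf mE exprMn fX exprS BX => E.
  transitivity (B n.-1 * (B 1 * B m * f)); first by rewrite !mulrA Bx mul1r.
  by rewrite E mulrA Bx mul1r.
rewrite ltnNge; apply: contra xf => g1.
have g0 : gcdn n m = 1%N.
  by apply/eqP; rewrite eqn_leq g1 gcdn_gt0 n0.
have [u v E _] := egcdnP m n0; rewrite g0 in E.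
have h : B (v * m + 1)%N * f = f by rewrite -E mulnC fixM ?Bn ?mul1r.
have hv : B (v * m)%N * f = f by rewrite mulnC fixM.
by rewrite BD mulrAC hv mulrC /B expg1 in h; rewrite h.
Qed.

Lemma card_ideal_avg : #|ideal avg| = q.
Proof.
have -> : ideal avg = [set (k *: [ffun=> 1] : FG) | k : F].
  apply/setP=> a; apply/(idealP (a : A) avg)/imsetP=> [aE|[k _ ->]].
    exists (n%:R^-1 * \sum_x (a : FG) x) => //.
    by rewrite -avg_mul -[LHS]aE mulrC.
  rewrite mulrC; apply: (avg_fixed coGq) => x.
  by apply/ffunP=> z; rewrite grpelt_mulE !ffunE.
rewrite card_imset // => k l /ffunP/(_ 1%g); rewrite !ffunE => kl.
by rewrite -[k]mulr1 -[l]mulr1.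
Qed.

Lemma card_grpalg : #|A| = (q ^ n)%N.
Proof. exact: card_ffun. Qed.

Lemma card_ideal_aug : #|ideal aug| = (q ^ n.-1)%N.
Proof.
have [[aa _] [ee _]] := (stableP _ _ stab_avg, stableP _ _ stab_aug).
have ae := mul_avg_aug abG coGq.
have := card_ideal_add aa ee ae; rewrite card_ideal_avg.
have -> : avg + aug = 1 by rewrite addrC subrK.
have -> : ideal (1 : A) = setT by apply/setP=> a; rewrite !inE mulr1 eqxx.
rewrite cardsT card_grpalg -{1}(prednK (ltnW G_gt1)) expnS => /eqP.
by rewrite eqn_pmul2l ?(ltnW (card_finNzRing_gt1 F)) // => /eqP.
Qed.

(* The inverse D of the relative distance is such that k = 1 + 1/128 and
   s = 1/(128 q) satisfy k^64 <= q, 1 + q s <= k and 1 <= s k^D. *)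
Definition distance_inv := (128 * 128 * q)%N.

Lemma card_low_weight_hull (T : realFieldType) (f : A) : (n ^ 8 <= q ^ mu q n)%N ->
    stable bar f -> f * aug = f -> f != 0 ->
  (#|[set p : A * A | (distance_inv * hweight (p : grpalg2 F gT) <= code_length gT)%N
        & ((p.1 * aug)%R \in ideal f) && ((p.2 * aug)%R \in ideal f)]| ^ 4 <= #|ideal f|)%N.
Proof.
move=> nq sf fa f0; have q1 := card_finNzRing_gt1 F.
have [ff _] := stableP _ _ sf; have [aa _] := stableP _ _ stab_avg.
have favg : f * avg = 0 by rewrite -fa -mulrA (mulrC aug) (mul_avg_aug abG coGq) mulr0.
have Xge := ideal_ge ff fa f0; set X := #|ideal f| in Xge *.
pose I : {set FG} := ideal (f + avg).
have [J sepJ IJ] := information_set (@ideal_zero (f + avg)) (@ideal_add _) (@ideal_scale _).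
have JX : (q ^ #|J| <= X ^ 2)%N.
  rewrite -(IJ : #|ideal (f + avg)| = _) card_ideal_add // card_ideal_avg -mulnn leq_mul2l;
    apply/orP; right.
  apply: leq_trans Xge; rewrite -[X in (X <= _)%N]expn1 leq_exp2l //.
  exact: mu_gt0.
set L := [set p | _ & _].
pose k : T := 1 + 128^-1; pose s : T := (128 * q%:R)^-1.
have q0 : (0 : T) < q%:R by rewrite ltr0n ltnW.
have s0 : 0 < s by rewrite invr_gt0 mulr_gt0.
have sk : 1 + q%:R * s <= k by rewrite /k /s invfM mulrCA mulfV ?mulr1 // gt_eqF.
have skD : 1 <= s * k ^+ distance_inv.
  rewrite mulrC ler_pdivlMr ?mulr_gt0 // mul1r.
  apply: le_trans (bernoulli _ _); last by lra.
  by rewrite /distance_inv !natrM; lra.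
have k64 : k ^+ 64 <= q%:R.
  apply: (@le_trans _ _ 2); last by rewrite ler_nat.
  have := @bernoulli T (- 128^-1) 64; rewrite lerNl opprK invf_le1 // ler1n => /(_ isT);
    set h := (1 - _) ^+ 64 => h2.
  have kh : k ^+ 64 * h <= 1 by rewrite -exprMn exprn_ile1 // /k; lra.
  have k640 : 0 <= k ^+ 64 by rewrite exprn_ge0 // /k; lra.
  by nra.
have low := card_low_weight (@ideal_add _) (@ideal_scale _) sepJ s0 skD sk
  (fun x => @ideal_mull (f + avg) (grpelt F x)).
have LI : (#|L| <= #|[set p in setX I I | (distance_inv * hweight (p : grpalg2 F gT) <=
  code_length gT)%N]|)%N.
  apply/subset_leq_card/fintype.subsetP=> -[a b]; rewrite inE => /andP[ab /andP[/= aI bI]].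
  rewrite inE ab andbT in_setX.
  have K (c : A) : c * aug \in ideal f -> c \in ideal (f + avg).
    move=> /(idealP (c * aug) f) cI; apply/(idealP c _).
    have -> : c = c * aug + c * avg by rewrite -mulrDr /grpalg_aug subrK mulr1.
    rewrite mulrDl (mulrDr (c * aug)) (mulrDr (c * avg)) cI -[c * aug * avg]mulrA -[c * avg *
      f]mulrA -[c * avg * avg]mulrA.
    by rewrite (mulrC avg f) favg (mulrC aug) (mul_avg_aug abG coGq) aa !mulr0 add0r addr0.
  by apply/andP; split; apply: K.
have k0 : 0 < k by rewrite /k; lra.
rewrite -(@leq_exp2r _ _ 4) // -(ler_nat T) natrX.
apply: (@le_trans _ _ ((n%:R ^+ 4 * k ^+ (16 * #|J|)) ^+ 4)).
  apply: lerXn2r; rewrite ?nnegrE ?mulr_ge0 ?exprn_ge0 ?(ltW k0) //.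
  rewrite natrX (_ : 16 * #|J| = 4 * #|J| * 4)%N; last by rewrite mulnAC.
  rewrite exprM -exprMn; apply: lerXn2r; rewrite ?nnegrE ?mulr_ge0 ?exprn_ge0 ?(ltW k0) //.
  by apply: le_trans low; rewrite ler_nat.
rewrite exprMn -!exprM (_ : 16 * #|J| * 4 = 64 * #|J|)%N; last by rewrite mulnAC.
apply: (@le_trans _ _ ((X ^ 2)%:R * (X ^ 2)%:R)); last by rewrite -natrM -expnD.
apply: ler_pM; rewrite ?exprn_ge0 ?(ltW k0) //.
  rewrite -natrX ler_nat (expnM _ 8 2) leq_exp2r //; exact: leq_trans nq Xge.
rewrite exprM; apply: (@le_trans _ _ (q%:R ^+ #|J|)).
  by apply: lerXn2r; rewrite ?nnegrE ?exprn_ge0 ?(ltW k0) // ltW.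
by rewrite -natrX ler_nat.
Qed.

Lemma exists_norm : exists2 b : A, b * aug = b & b * bar b = - aug.
Proof.
have [ee _] := stableP _ _ stab_aug.
exact: (norm_opp (@grpalg_barK _ _ abG) Q_gt2 expQ bnt stab_aug ee).
Qed.

Lemma exists_good_norm (T : rcfType) : (n ^ 8 <= q ^ mu q n)%N ->
  exists b : A, [/\ b * aug = b, b * bar b = - aug
    & forall u v : A, (distance_inv * hweight ((u, v) : grpalg2 F gT) <= code_length gT)%N ->
        v * aug = u * b -> u * aug = 0].
Proof.
move=> nq; have n2 : (2 < n)%N.
  by rewrite ltn_neqAle G_gt1 andbT; apply: contraTneq oddG => <-.
have [||b [bE bN H]] := @exists_norm_avoiding A bar _ (@grpalg_barK _ _ abG) Q_gt2 expQ
  aug stab_aug bnt T (q ^ mu q n) n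
  [set p : A * A | (distance_inv * hweight (p : grpalg2 F gT) <= code_length gT)%N] n2 nq _
    ideal_ge _.
- rewrite card_ideal_aug -expnM leq_exp2l ?card_finNzRing_gt1 //.
  by rewrite (leq_trans (leq_pred n)) // leq_pmull // mu_gt0.
- move=> f sf fa f0; apply: leq_trans (card_low_weight_hull T nq sf fa f0).
  rewrite leq_exp2r //; apply/subset_leq_card/fintype.subsetP=> p.
  by rewrite inE => /andP[]; rewrite inE => h1 h2; rewrite inE h1.
exists b; split=> // u v uv; apply: (H (u, v)).
by rewrite inE.
Qed.
End GoodUnits.

(** * Codes *)

Section GeneratedCodes.
Variables (F : finFieldType) (gT : finGroupType).
Local Notation FG := (grpalg F gT).
Local Notation code := {vspace grpalg2 F gT}.

Definition gen_map (c d : FG) (a : FG) : grpalg2 F gT := (a * c, a * d).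

Lemma gen_map_is_linear c d : linear (gen_map c d).
Proof. by move=> k a b; rewrite /gen_map !mulrDl -!scalerAl. Qed.

HB.instance Definition _ c d := GRing.isLinear.Build F FG (grpalg2 F gT) *:%R
  (gen_map c d) (gen_map_is_linear c d).

Definition gen_code (c d : FG) : code := limg (linfun (gen_map c d)).

Lemma gen_codeP c d u : reflect (exists a, u = (a * c, a * d)) (u \in gen_code c d).
Proof.
apply: (iffP memv_imgP) => [[a _ ->]|[a ->]]; exists a; rewrite ?lfunE ?memvf //.
Qed.

Lemma quasi_gen_code c d : quasi_code2 (gen_code c d).
Proof.
move=> x _ /gen_codeP[a ->]; apply/gen_codeP; exists (x * a) => /=.
by rewrite !mulrA.
Qed.

Lemma card_gen_code c d (S : {set FG}) : {in S &, injective (gen_map c d)} ->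
  (forall a, exists2 a', a' \in S & gen_map c d a = gen_map c d a') ->
  (#|F| ^ \dim (gen_code c d) = #|S|)%N.
Proof.
move=> injS surjS; rewrite -card_vspace -(card_in_imset injS); apply: eq_card => u.
apply/gen_codeP/imsetP=> [[a ->]|[a _ ->]]; last by exists a.
exact: surjS.
Qed.

Lemma hweight_gt0 (u : grpalg2 F gT) : u != 0 -> (0 < hweight u)%N.
Proof.
apply: contra_neqT; rewrite -eqn0Ngt addn_eq0 => /andP[/eqP/card0_eq u1 /eqP/card0_eq u2].
rewrite [u]surjective_pairing; congr (_, _); apply/ffunP=> x; rewrite !ffunE; apply/eqP/negbNE.
  exact/negbT/u1.
exact/negbT/u2.
Qed.

Lemma min_weight_attained (C : code) : C != 0%VS ->
  exists2 u, (u \in C) && (u != 0) & min_weight C = hweight u.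
Proof.
move=> C0; rewrite /min_weight; case: arg_minnP => [|u uC _]; last by exists u.
by rewrite memv_pick vpick0.
Qed.
End GeneratedCodes.

Section Existence.
Variables (F : finFieldType) (gT : finGroupType).
Hypothesis abG : abelian [set: gT].
Hypotheses (oddG : odd #|gT|) (coGq : coprime #|gT| #|F|) (G_gt1 : (1 < #|gT|)%N).
Local Notation q := #|F|.
Local Notation n := #|gT|.
Local Notation FG := (grpalg F gT).
Local Notation A := (comGrpalg F abG).
Local Notation bar := (grpalg_bar (F := F) (abG := abG) : {rmorphism A -> A}).
Local Notation avg := (grpalg_avg F gT : A).
Local Notation aug := (grpalg_aug F abG).

Let stab_avg : stable bar avg. Proof. exact: stable_avg. Qed.
Let stab_aug : stable bar aug. Proof. exact: stable_aug. Qed.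

Lemma gen_code_self_orthogonal (c d : A) :
  c * bar c + d * bar d = 0 -> self_orthogonal (gen_code (c : FG) d).
Proof.
move=> cd0 v vC; rewrite inE; apply/forall_inP=> u uC.
have /gen_codeP[a ->] := uC; have /gen_codeP[a' ->] := vC.
rewrite (inner_bar abG) /=.
have -> : ((a : A) * c) * bar ((a' : A) * c) + ((a : A) * d) * bar ((a' : A) * d) = 0.
  by rewrite !rmorphM /= (mulrACA (a : A) c) (mulrACA (a : A) d) -mulrDr cd0 mulr0.
by rewrite ffunE.
Qed.

Definition far_code (C : {vspace grpalg2 F gT}) := (n ^ 8 <= q ^ mu q n)%N ->
  forall u, u \in C -> u != 0 -> (code_length gT < distance_inv F * hweight u)%N.

Lemma exists_far_norm (T : rcfType) : exists b : A, [/\ b * aug = b, b * bar b = - aug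
    & (n ^ 8 <= q ^ mu q n)%N -> forall u v : A,
      (distance_inv F * hweight ((u, v) : grpalg2 F gT) <= code_length gT)%N ->
        v * aug = u * b -> u * aug = 0].
Proof.
have [nq|nq] := boolP (n ^ 8 <= q ^ mu q n)%N.
  by have [b [? ? ?]] := exists_good_norm abG oddG coGq G_gt1 T nq; exists b.
by have [b ? ?] := exists_norm abG oddG coGq G_gt1; exists b.
Qed.

Lemma exists_self_orthogonal (T : rcfType) : exists C : {vspace grpalg2 F gT},
  [/\ quasi_code2 C, self_orthogonal C, \dim C = (n - 1)%N & far_code C].
Proof.
have [b [be bN far]] := exists_far_norm T.
have [ee eb] := stableP _ _ stab_aug.
exists (gen_code (aug : FG) b); split.
- exact: quasi_gen_code.
- by apply: gen_code_self_orthogonal; rewrite eb ee bN subrr.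
- apply/eqP; rewrite -(eqn_exp2l _ _ (card_finNzRing_gt1 F)); apply/eqP.
  rewrite (@card_gen_code _ _ _ _ (ideal aug : {set FG})).
  + by rewrite (card_ideal_aug abG coGq G_gt1) subn1.
  + move=> a a' /(idealP (a : A) aug) aE /(idealP (a' : A) aug) a'E [E _].
    by rewrite -[LHS]aE -[RHS]a'E; exact: E.
  + move=> a; exists ((a : A) * aug); first by apply/(idealP ((a : A) * aug));
    rewrite -mulrA ee.
    congr (_, _); first by rewrite -[LHS]/((a : A) * aug) -[RHS]/((a : A) * aug * aug) -mulrA
      ee.
    by rewrite -[LHS]/((a : A) * b) -[RHS]/((a : A) * aug * b) -mulrA (mulrC aug) be.
move=> nq _ /gen_codeP[a ->] u0; rewrite ltnNge; apply: contra u0 => low.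
have ae : (a : A) * aug = 0.
  have := far nq ((a : A) * aug) ((a : A) * b) low.
  by rewrite -!mulrA be ee (mulrC aug) be => /(_ erefl).
apply/eqP; congr (_, _); first exact: ae.
by rewrite -[LHS]/((a : A) * b) -be (mulrC b) mulrA ae mul0r.
Qed.

Lemma exists_self_dual (T : rcfType) (x : F) : x ^+ 2 = -1 ->
  exists C : {vspace grpalg2 F gT},
  [/\ quasi_code2 C, self_dual C, \dim C = n & far_code C].
Proof.
move=> x2; have [b [be bN far]] := exists_far_norm T.
have [ee eb] := stableP _ _ stab_aug; have [aa ab] := stableP _ _ stab_avg.
have ae0 := mul_avg_aug abG coGq.
pose xa : A := (x *: (1 : FG) : A) * avg.
have x1b : bar (x *: (1 : FG)) = x *: (1 : FG).
  by apply/ffunP=> y; rewrite !ffunE eq_invg1.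
have x1x1 : (x *: (1 : FG) : A) * (x *: (1 : FG) : A) = - 1.
  rewrite -[LHS]/((x *: (1 : FG)) * (x *: (1 : FG))) -scalerAl mul1r scalerA -expr2 x2.
  by rewrite scaleN1r.
have xab : bar xa = xa by rewrite rmorphM /= x1b ab.
have xaxa : xa * xa = - avg by rewrite /xa mulrACA x1x1 aa mulN1r.
have bxa : b * xa = 0 by rewrite -be /xa mulrCA -(mulrA b) (mulrC aug) ae0 !mulr0.
pose d : A := b + xa.
have dN : d * bar d = - 1.
  rewrite rmorphD /= xab mulrDl !mulrDr bN xaxa bxa.
  have -> : xa * bar b = 0 by rewrite -xab -rmorphM (mulrC xa) bxa rmorph0.
  by rewrite addr0 add0r -opprD subrK.
have daug : d * aug = b.
  by rewrite mulrDl be /xa -mulrA ae0 mulr0 addr0.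
exists (gen_code (1 : FG) d); split.
- exact: quasi_gen_code.
- move=> v; apply/idP/idP.
    by apply: gen_code_self_orthogonal; rewrite rmorph1 mulr1 dN subrr.
  rewrite inE => /forall_inP H; apply/gen_codeP; exists v.1.
  have E : bar v.1 + d * bar v.2 = 0.
    apply/ffunP=> y; rewrite [RHS]ffunE.
    have uC : (grpelt F y^-1%g * 1, grpelt F y^-1%g * d) \in gen_code (1 : FG) d.
      by apply/gen_codeP; exists (grpelt F y^-1%g).
    have /eqP := H _ uC; rewrite (inner_bar abG) /= mulr1.
    have -> : (grpelt F y^-1%g * bar v.1 + grpelt F y^-1%g * d * bar v.2 : FG) =
              grpelt F y^-1%g * (bar v.1 + d * bar v.2).
      have K (g u w z : A) : g * u + g * w * z = g * (u + w * z) by rewrite mulrDr mulrA.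
      exact: K.
    by rewrite grpelt_mulE invgK mulg1.
  have E2 : (v.1 : A) + bar d * v.2 = 0.
    by have := congr1 bar E; rewrite rmorphD rmorphM /= !(grpalg_barK (abG := abG)) rmorph0.
  rewrite mulr1 [LHS]surjective_pairing; congr (_, _).
  rewrite -[RHS]/((v.1 : A) * d) -[v.1 : A](addrK (bar d * v.2)) E2 add0r mulNr.
  by rewrite mulrAC (mulrC (bar d)) dN mulN1r opprK.
- apply/eqP; rewrite -(eqn_exp2l _ _ (card_finNzRing_gt1 F)); apply/eqP.
  rewrite (@card_gen_code _ _ _ _ (setT : {set FG})).
  + by rewrite cardsT; exact: (card_grpalg F abG).
  + by move=> a a' _ _ [E _]; rewrite !mulr1 in E.
  + by move=> a; exists a; rewrite ?inE.
move=> nq _ /gen_codeP[a ->] u0; rewrite ltnNge; apply/negP => low.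
have ae : (a : A) * aug = 0.
  have := far nq ((a : A) * 1) ((a : A) * d) low.
  by rewrite -mulrA daug mulr1 => /(_ erefl).
have aE : (a : A) = a * avg.
  by rewrite -[LHS]mulr1 -(subrK avg 1) mulrDr ae add0r.
have adE : (a : A) * d = x *: (a : FG).
  have avgb : avg * b = 0 by rewrite -be mulrCA ae0 mulr0.
  rewrite [in LHS]aE -mulrA mulrDr avgb add0r /xa (mulrCA avg) aa (mulrCA (a : A)) -aE.
  by rewrite -[LHS]/((x *: (1 : FG)) * (a : FG)) -scalerAl mul1r.
have aC y : (a : FG) y = (a : FG) 1%g.
  have -> : a = grpalg_avg F gT * (a : FG) by rewrite -[RHS]/(avg * (a : A)) mulrC -aE.
  by rewrite avg_mul !ffunE.
have x0 : x != 0.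
  apply: contra_eq_neq x2 => ->; rewrite expr0n /= eq_sym oppr_eq0; exact: oner_neq0.
have a1 : (a : FG) 1%g != 0.
  apply: contraNneq u0 => a10.
  have -> : a = 0 :> FG by apply/ffunP=> y; rewrite aC a10 ffunE.
  by rewrite !mul0r.
have hw : hweight ((a * 1, a * d) : grpalg2 F gT) = (n + n)%N.
  have -> : (a * 1, a * d) = (a, x *: (a : FG)) :> grpalg2 F gT.
    by congr (_, _); [exact: mulr1 | exact: adE].
  by congr (_ + _)%N; apply: eq_card => y; rewrite !inE /= ?ffunE aC //; apply: mulf_neq0.
move: low; rewrite hw /code_length.
rewrite addnn -muln2 (mulnC n) leqNgt -[X in (X < _)%N]mul1n ltn_pmul2r.
  by rewrite (leq_trans (card_finNzRing_gt1 F)) // leq_pmull.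
by rewrite muln_gt0 (ltnW G_gt1).
Qed.
End Existence.

From mathcomp Require Import all_classical all_reals all_analysis.
Import numFieldNormedType.Exports.

Section Asymptotics.
Variables (R : realType) (F : finFieldType) (n : nat -> nat).
Hypotheses (n_gt1 : forall i, (1 < n i)%N) (n_odd : forall i, odd (n i)).
Hypothesis n_lim : ((fun i => logb #|F|%:R (n i)%:R / (mu #|F| (n i))%:R : R)
                @ \oo --> (0 : R))%classic.
Variable gT : nat -> finGroupType.
Hypothesis gT_card : forall i, #|gT i| = n i.
Local Notation q := #|F|.

Lemma eventually_pow_le k :
  exists N, forall i, (N <= i)%N -> (n i ^ k <= q ^ mu q (n i))%N.
Proof.
have q1 : (1 < q)%N := card_finNzRing_gt1 F.
have k0 : 0 < (k.+1%:R)^-1 :> R by rewrite invr_gt0.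
have [N _ H] := cvgr0_norm_lt _ n_lim _ k0.
exists N => i /H /= {}H.
have m0 : (0 < mu q (n i))%N by apply: mu_gt0.
have lq : 0 < ln (q%:R : R) by rewrite ln_gt0 // ltr1n.
have n0 : (0 < n i)%N := ltnW (n_gt1 i).
have ln0 : 0 <= ln ((n i)%:R : R) by rewrite ln_ge0 // ler1n.
move: H; rewrite ger0_norm; last by rewrite !divr_ge0 // ltW.
rewrite ltr_pdivrMr ?ltr0n // /logb ltr_pdivrMr // -mulrA ltr_pdivlMl // => H.
rewrite -(ler_nat R) !natrX -ler_ln ?posrE ?exprn_gt0 ?ltr0n // ?(ltnW q1) //.
rewrite !lnXn ?ltr0n // ?(ltnW q1) // -![ln _ *+ _]mulr_natl.
apply: le_trans (ltW H); rewrite ler_wpM2r // ler_nat //.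
Qed.

Lemma min_weight_gt0 i (C : {vspace grpalg2 F (gT i)}) : C != 0%VS ->
  (0 < min_weight C)%N.
Proof. by move=> /min_weight_attained[u /andP[_ u0] ->]; apply: hweight_gt0. Qed.

Lemma far_codes_good (C : forall i, {vspace grpalg2 F (gT i)}) :
  (forall i, n i - 1 <= \dim (C i))%N -> (forall i, far_code (C i)) ->
  asymptotically_good R C.
Proof.
move=> dimC farC; have q1 : (1 < q)%N := card_finNzRing_gt1 F.
have n2 i : (2 < n i)%N.
  by rewrite ltn_neqAle n_gt1 andbT; apply: contraTneq (n_odd i) => <-.
split.
  apply/cvgnyPge => B; have [N H] := eventually_pow_le (q * B).
  exists N => // i /= /H h; rewrite /code_length gT_card.
  apply: (@leq_trans (n i)); last by rewrite leq_pmull.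
  rewrite leqNgt; apply: contraL h => nB; rewrite -ltnNge.
  apply: (@leq_ltn_trans (q ^ n i)); first by rewrite leq_exp2l ?mu_le_modulus.
  apply: (@ltn_trans (q ^ B)); first by rewrite ltn_exp2l.
  rewrite expnM ltn_exp2r; last exact: leq_ltn_trans nB.
  apply: (@leq_trans (2 ^ q)); first exact: ltn_expl.
  by rewrite leq_exp2r ?(ltnW q1).
have [N H] := eventually_pow_le 8.
pose M := (distance_inv F + 3 + \sum_(i < N) 2 * n i)%N.
have M0 : (0 < M)%N by rewrite /M addn3.
have bnd w m : (0 < m)%N -> (m <= M * w)%N -> (M%:R)^-1 <= w%:R / m%:R :> R.
  move=> m0 mw; rewrite ler_pdivlMr ?ltr0n // ler_pdivrMl ?ltr0n //.
  by rewrite -natrM ler_nat.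
exists (M%:R)^-1; first by rewrite invr_gt0 ltr0n.
move=> i; have cl : code_length (gT i) = (2 * n i)%N by rewrite /code_length gT_card.
have cl0 : (0 < code_length (gT i))%N by rewrite cl muln_gt0 (ltnW (n_gt1 i)).
have C0 : C i != 0%VS.
  by rewrite -dimv_eq0 -lt0n (leq_trans _ (dimC i)) // subn_gt0.
split; apply: bnd => //.
  apply: (@leq_trans (3 * (n i - 1))); first by rewrite cl; have := n2 i; lia.
  by apply: leq_mul => //; rewrite /M; lia.
have [leN|ltN] := leqP N i.
  have [u /andP[uC u0] ->] := min_weight_attained C0.
  have := farC i; rewrite /far_code gT_card => /(_ (H i leN) u uC u0) /ltnW h.
  by apply: leq_trans h _; rewrite leq_mul2r /M -addnA leq_addr orbT.
apply: (@leq_trans (M * 1)); last by rewrite leq_mul2l min_weight_gt0 ?orbT.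
rewrite muln1 cl /M (bigD1 (Ordinal ltN)) //=; lia.
Qed.
End Asymptotics.

Theorem theorem1p1 (R : realType) (F : finFieldType) (n : nat -> nat)
    (n_gt1 : forall i, (1 < n i)%N)
    (n_odd : forall i, odd (n i))
    (n_coprime : forall i, coprime (n i) #|F|)
    (n_lim : ((fun i => logb #|F|%:R (n i)%:R / (mu #|F| (n i))%:R : R)
                @ \oo --> (0 : R))%classic)
    (gT : nat -> finGroupType)
    (gT_abelian : forall i, abelian [set: gT i]%G)
    (gT_card : forall i, #|gT i| = n i) :
  (exists C : forall i, {vspace grpalg2 F (gT i)},
      (forall i, [/\ quasi_code2 (C i), self_orthogonal (C i)
                   & \dim (C i) = (n i - 1)%N]) /\
      asymptotically_good R C) /\
  ((exists x : F, x ^+ 2 = -1) ->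
   exists C : forall i, {vspace grpalg2 F (gT i)},
      (forall i, quasi_code2 (C i) /\ self_dual (C i)) /\
      asymptotically_good R C).
Proof.
have G i : [/\ odd #|gT i|, coprime #|gT i| #|F| & (1 < #|gT i|)%N].
  by rewrite gT_card.
split=> [|[x x2]].
  have exC i : exists C : {vspace grpalg2 F (gT i)},
      [/\ quasi_code2 C, self_orthogonal C, \dim C = (#|gT i| - 1)%N & far_code C].
    by case: (G i) => o c g; apply: (exists_self_orthogonal (gT_abelian i) o c g R).
  exists (fun i => projT1 (cid (exC i))); split=> [i|].
    by case: cid => C [? ? d ?]; split=> //; rewrite d gT_card.
  apply: (far_codes_good n_gt1 n_odd n_lim gT_card) => i; case: cid => C [] // _ _ -> _.
  by rewrite gT_card.
have exC i : exists C : {vspace grpalg2 F (gT i)},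
    [/\ quasi_code2 C, self_dual C, \dim C = #|gT i| & far_code C].
  by case: (G i) => o c g; apply: (exists_self_dual (gT_abelian i) o c g R x2).
exists (fun i => projT1 (cid (exC i))); split=> [i|].
  by case: cid => C [].
apply: (far_codes_good n_gt1 n_odd n_lim gT_card) => i; case: cid => C [] // _ _ -> _.
by rewrite gT_card leq_subr.
Qed.
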